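(* Let $k \in \mathbb{N}$ and let $\phi_s \in \Phi$ for $s > 0$, with $\mathbb{E}\, N_{k}(G(\mathcal{P}_s,\phi_s)) \to \alpha \in (0,\infty)$ as $s\to\infty$. (a) If $\overline{\phi}_s = o(1/\log s)$ as $s\to\infty$, then $N_k(G(\mathcal{P}_s,\phi_s)) \stackrel{\mathcal{D}}{\longrightarrow} Z_\alpha$ as $s\to\infty$. (b) If $\overline{\phi}_s = o(s^{-1/2})$ as $s\to\infty$, then $N_k(G(\mathcal{X}_{\lfloor s\rfloor},\phi_{\lfloor s\rfloor})) \stackrel{\mathcal{D}}{\longrightarrow} Z_\alpha$ as $s\to\infty$.
   Context: $(\mathbb{X},\mathcal{F},\mu)$ is an arbitrary probability space. $\Phi$ is the class of all measurable symmetric functions $\phi:\mathbb{X}\times\mathbb{X}\to[0,1]$ (connection functions), and $\overline{\phi} := \sup_{x,y}\phi(x,y)$; $\overline{\phi}_s$ denotes $\overline{\phi}$ for $\phi=\phi_s$. Let $X_1,X_2,\ldots$ be independent random elements of $\mathbb{X}$ with common distribution $\mu$. For $n\in\mathbb{N}$, $\mathcal{X}_n=\{X_1,\ldots,X_n\}$ (binomial point process). For real $s>0$, $\mathcal{P}_s$ is the Poisson point process $\{X_1,\ldots,X_{N}\}$, where $N$ is Poisson with mean $s$, independent of $(X_i)$; it has mean measure $s\mu$. (Points are counted with multiplicity, i.e. vertices are distinguished by their index $i$.) For $\phi\in\Phi$ and a finite collection $\mathcal{V}$ of points of $\mathbb{X}$ (possibly with multiplicity), $G(\mathcal{V},\phi)$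 is the random undirected graph with vertex set $\mathcal{V}$ in which each pair $\{x,y\}$ of points of $\mathcal{V}$ is joined by an edge with probability $\phi(x,y)$, independently of all other pairs; $G(\mathcal{P}_s,\phi)$ and $G(\mathcal{X}_n,\phi)$ are obtained in this way conditionally on the point process. For a graph $G$ and $k\in\mathbb{N}$, $N_k(G)$ is the number of connected components of $G$ with exactly $k$ vertices. $Z_\alpha$ is a Poisson random variable with parameter $\alpha$, and $\stackrel{\mathcal{D}}{\longrightarrow}$ denotes convergence in distribution. $u(s)=o(v(s))$ means $\lim_{s\to\infty}u(s)/v(s)=0$. *)

(* Defs.v *)
From HB Require Import structures.
From mathcomp Require Import all_boot all_order all_algebra.
From mathcomp Require Import finmap.
From mathcomp Require Import all_classical all_reals all_analysis.

Set Implicit Arguments.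
Unset Strict Implicit.
Unset Printing Implicit Defensive.

Import Order.TTheory GRing.Theory Num.Theory.
Import numFieldNormedType.Exports.

Local Open Scope classical_set_scope.
Local Open Scope ring_scope.

Definition num_components (V : finType) (e : rel V) (k : nat) : nat :=
  #|[set C in equivalence_partition (connect e) [set: V]%SET
       | #|C : {set V}| == k]%SET|.

(* The undirected simple graph on the indices 0, ..., n - 1 whose edges are
   read off the entries of [e] above the diagonal: points of a collection are
   told apart by their index, so two points at the same location are two
   vertices. *)
Definition graph_on (n : nat) (e : nat -> nat -> bool) : rel 'I_n :=
  fun i j => (i < j)%N && e i j || (j < i)%N && e j i.

Section connection_functions.
Context d (T : measurableType d) (R : realType).
Implicit Type phi : T -> T -> R.

Definition connection_function phi : Prop :=
  [/\ measurable_fun [set: T * T] (fun xy => phi xy.1 xy.2),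
      forall x y, phi x y = phi y x
    & forall x y, 0 <= phi x y <= 1].

Definition phibar phi : R := sup (range (fun xy : T * T => phi xy.1 xy.2)).

(* The probability that independent edges between the fixed points
   [x 0], ..., [x (n - 1)] form exactly the graph with edge indicators [g];
   only the values [g i j] with [i < j] are used. *)
Definition graph_prob phi (n : nat) (x : 'I_n -> T) (g : 'I_n -> 'I_n -> bool)
    : R :=
  \prod_(i < n) \prod_(j < n | (i < j)%N)
    (if g i j then phi (x i) (x j) else 1 - phi (x i) (x j)).

End connection_functions.

Section random_elements.
Context d (Omega : measurableType d) (R : realType) (P : probability Omega R).

Definition has_law d' (T : measurableType d') (X : {RV P >-> T})
    (mu : set T -> \bar R) : Prop :=
  forall A, measurable A -> distribution P X A = mu A.

Definition mutually_independent d' (T : measurableType d')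
    (X : nat -> {RV P >-> T}) : Prop :=
  forall (J : {fset nat}) (A : nat -> set T), (forall i, measurable (A i)) ->
    P (\bigcap_(i in [set` J]) X i @^-1` A i) =
    (\prod_(i <- J) P (X i @^-1` A i))%E.

Definition sigma_of_points d' (T : measurableType d')
    (X : nat -> {RV P >-> T}) (I : set nat) : set (set Omega) :=
  <<s \bigcup_(i in I) preimage_set_system [set: Omega] (X i) measurable >>.

Definition independent_of_points d' (T : measurableType d')
    (N : {RV P >-> nat}) (X : nat -> {RV P >-> T}) : Prop :=
  forall A B, sigma_of_points X [set: nat] B ->
    P (N @^-1` A `&` B) = (P (N @^-1` A) * P B)%E.

(* [E i j], for [i < j], indicates the edge between the points [X i] and [X j].
   Conditionally on the collection X 0, ..., X (N - 1), the edges are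
   independent and {X i, X j} is present with probability phi (X i) (X j): on
   {N = n}, the conditional probability of each graph on n vertices given
   X 0, ..., X (n - 1) is [graph_prob]. A collection of fixed size is obtained
   for a constant N. *)
Definition random_connection_graph d' (T : measurableType d')
    (phi : T -> T -> R) (X : nat -> {RV P >-> T}) (N : {RV P >-> nat})
    (E : nat -> nat -> {RV P >-> bool}) : Prop :=
  forall (n : nat) (g : 'I_n -> 'I_n -> bool) (B : set Omega),
    sigma_of_points X `I_n B ->
    P (B `&` N @^-1` [set n] `&`
         [set w | forall i j : 'I_n, (i < j)%N -> E i j w = g i j]) =
    (\int[P]_(w in B `&` N @^-1` [set n])
       (graph_prob phi (fun i => X i w) g)%:E)%E.

Definition component_count (N : {RV P >-> nat})
    (E : nat -> nat -> {RV P >-> bool}) (k : nat) (w : Omega) : R :=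
  (num_components (@graph_on (N w) (fun i j => E i j w)) k)%:R.

Section component_count_measurable.
Variables (N : {RV P >-> nat}) (E : nat -> nat -> {RV P >-> bool}) (k : nat).

Let measurable_component_count :
  measurable_fun [set: Omega] (component_count N E k).
Proof.
move=> _ Y mY; rewrite setTI.
pose S n (g : {ffun 'I_n * 'I_n -> bool}) : set Omega :=
  N @^-1` [set n] `&`
  \bigcap_(p in [set: 'I_n * 'I_n]) E p.1 p.2 @^-1` [set g p].
pose c n (g : {ffun 'I_n * 'I_n -> bool}) : R := (num_components
  (fun i j : 'I_n => (i < j)%N && g (i, j) || (j < i)%N && g (j, i)) k)%:R.
rewrite (_ : _ @^-1` _ =
    \bigcup_n \bigcup_(g in [set g | Y (c n g)]) S n g).
  apply: bigcup_measurable => n _.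
  apply: fin_bigcup_measurable => [|g _]; first exact: finite_finset.
  apply: measurableI; first exact: measurable_funPTI.
  by apply: fin_bigcap_measurable => [|p _];
    [exact: finite_finset | exact: measurable_funPTI].
have cE n (g : {ffun 'I_n * 'I_n -> bool}) w :
    (forall p : 'I_n * 'I_n, E p.1 p.2 w = g p) ->
    c n g = (num_components (@graph_on n (fun i j => E i j w)) k)%:R.
  move=> gE; congr (_%:R); congr num_components.
  by apply/funext => i; apply/funext => j; rewrite /graph_on -!gE.
apply/seteqP; split => w /=.
  move=> Yw; exists (N w) => //.
  exists [ffun p : 'I_(N w) * 'I_(N w) => (E p.1 p.2 w : bool)] => /=.
    by rewrite (cE _ _ w)// => p; rewrite ffunE.
  by split => // p _ /=; rewrite ffunE.
case=> n _ [g /= Yg [/= Nw gE]].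
by move: Yg; rewrite (cE _ _ w) -?Nw// => p; apply: gE.
Qed.

HB.instance Definition _ := isMeasurableFun.Build _ _ _ _
  (component_count N E k) measurable_component_count.

Definition component_RV : {RV P >-> R} := component_count N E k.

End component_count_measurable.

Definition cvg_in_distribution (I : Type) (F : set_system I)
    (Y : I -> {RV P >-> R}) d' (Omega' : measurableType d')
    (Q : probability Omega' R) (Z : {RV Q >-> R}) : Prop :=
  forall x : R, {for x, continuous (cdf Z)} ->
    cdf (Y s) x @[s --> F] --> cdf Z x.

End random_elements.

(* The second argument of [poisson_prob] is not used by the library. *)
Definition poisson_law (R : realType) (alpha : R) : probability nat R :=
  poisson_prob alpha 0%N.

Section poisson_variable.
Context (R : realType) (alpha : R).

Definition poisson_variable (m : nat) : R := m%:R.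

Let measurable_poisson_variable : measurable_fun [set: nat] poisson_variable.
Proof. by []. Qed.

HB.instance Definition _ := isMeasurableFun.Build _ _ _ _
  poisson_variable measurable_poisson_variable.

Definition Zpoisson : {RV (poisson_law alpha) >-> R} := poisson_variable.

End poisson_variable.

(* Main.v *)
(* The proof is by the method of factorial moments.  A factorial moment of order m
   counts ordered m-tuples of distinct components of size k.  Given the points,
   the probability that m disjoint groups of k points are all components is the
   product of the probabilities that each group is connected, times the
   probability that no edge leaves a group; the edges between the groups matter
   only up to a factor (1 - phibar) ^ ((m k) ^ 2).  Integrating out the other
   points replaces them by exp (- s (1 - V)) in the Poisson case and by
   V ^ (n - m k) in the binomial case, V being the probability that a new point
   is joined to none of the groups.  To first order 1 - V is the sum of the mean
   degrees of the m k points, so the integral nearly factorises over the groups.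
   The relative error is exp (O (s phibar D)) where D is that sum; it tends to 1
   on {s D <= C log s} because phibar = o(1 / log s), and for C large the
   complement contributes o(1) even after multiplication by s ^ (m k).  Hence the
   m-th factorial moment is asymptotic to the m-th power of the first one, which
   tends to alpha.  Bonferroni's inequalities turn convergence of the factorial
   moments to alpha ^ m into convergence of the point probabilities. *)
Require Import Defs.
From HB Require Import structures.
From mathcomp Require Import all_boot all_order all_algebra.
From mathcomp Require Import finmap ring lra.
From mathcomp Require Import all_classical all_reals all_analysis.
From mathcomp Require Import measurable_realfun.

Set Implicit Arguments.
Unset Strict Implicit.
Unset Printing Implicit Defensive.

Import Order.TTheory GRing.Theory Num.Theory.
Import numFieldNormedType.Exports.

(** * Tuples of components as injections *)

(** Only the first Poisson moment is assumed to converge, and its integral is never evaluated. A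
    single quantity, [rho = s ^ k * reference_integral], the same for all m, serves as yardstick: up
    to factors tending to 1 and an error tending to 0, [k! ^ m] times the m-th factorial moment is
    [rho ^ m]. For m = 1 this forces [rho] to tend to [k! * alpha], and every other moment follows.
    The comparison is lopsided. The union bound 1 - V <= D gives the lower bound by [rho ^ m] with
    no error. In the upper bound the exponent s phibar D need not stay bounded, which is what makes
    a cutoff necessary. The binomial case returns to the Poisson integral at s = n. There the second
    order term of log V is multiplied by n and is of size n phibar ^ 2, the quantity that the rate s
    ^ (-1/2) controls. Points are handled through the law of the whole infinite sequence.
    Independence and exchangeability are both used in one form: this law is unchanged when the
    coordinates are read injectively from two independent copies. *)

(** No edge leaves a connectivity class, so a path between two of its vertices stays inside and can
    be pulled back along [f]. Conversely, a path starting in the image can never leave it.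
    Positivity of [k] provides a representative of the class. *)
Lemma component_image (V : finType) (k : nat) (e : rel V) (f : 'I_k -> V) :
  symmetric e -> injective f -> (0 < k)%N ->
  (f @: [set: 'I_k] \in equivalence_partition (connect e) [set: V]) =
  [forall a, forall b, connect (relpre f e) a b] &&
  [forall u, forall v, (u \in codom f) && (v \notin codom f) ==> ~~ e u v].
Proof.
move=> e_sym f_inj k_gt0.
have imE v : (v \in f @: [set: 'I_k]) = (v \in codom f).
  apply/finset.imsetP/codomP => [[a _ ->]|[a ->]]; first by exists a.
  by exists a.
have csym := sym_connect_sym e_sym.
apply/finset.imsetP/andP.
- case=> x _ fx.
  have fxE v : (v \in codom f) = connect e x v.
    by rewrite -imE fx !inE.
  have closed_f u v : u \in codom f -> e u v -> v \in codom f.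
    by rewrite !fxE => xu uv; apply: connect_trans xu _; exact: connect1.
  split; last first.
    apply/forallP => u; apply/forallP => v; apply/implyP => /andP[uf].
    by apply: contra; exact: closed_f.
  apply/forallP => a; apply/forallP => b.
  have : connect e (f a) (f b).
    by apply: (@connect_trans _ _ x); [rewrite csym|]; rewrite -fxE codom_f.
  case/connectP => p; elim: p a => [|y p IHp] a /=.
    by move=> _ /f_inj ->.
  case/andP => ay yp yb.
  have /codomP[c yE] : y \in codom f by apply: closed_f ay; exact: codom_f.
  apply: (@connect_trans _ _ c); first by apply: connect1; rewrite /= -yE.
  by apply: IHp; rewrite -yE.
- case=> /forallP conn_f /forallP closed_f.
  pose a0 := Ordinal k_gt0.
  exists (f a0) => //; apply/setP => v; rewrite imE !inE /=.
  apply/idP/idP => [/codomP[b ->]|].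
    have /connectP[p] := forallP (conn_f a0) b.
    elim: p {conn_f} a0 => [|y p IHp] a /=; first by move=> _ ->; exact: connect0.
    case/andP => ay yp yb; apply: (@connect_trans _ _ (f y)); first exact: connect1.
    exact: IHp.
  have : f a0 \in codom f by exact: codom_f.
  move: (f a0) => u uf /connectP[p].
  elim: p u uf => [|y p IHp] u uf /=; first by move=> _ ->.
  case/andP => uy yp vy; apply: (IHp y) => //.
  apply/negPn/negP => yf; have /forallP/(_ y) := closed_f u.
  by rewrite uf yf uy.
Qed.

Lemma card_injective_image (V : finType) (k : nat) (C : {set V}) :
  #|C| = k ->
  #|[pred g : {ffun 'I_k -> V} | injectiveb g & g @: [set: 'I_k] == C]| = k`!.
Proof.
move=> Ck; transitivity (#|C| ^_ #|'I_k|); last by rewrite Ck card_ord ffactnn.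
rewrite -card_inj_ffuns_on.
apply: eq_card => g; rewrite !inE andbC; apply: andb_id2r => /injectiveP g_inj.
apply/idP/idP => [/eqP <-|/ffun_onP gC].
  by apply/ffun_onP => a; exact: finset.imset_f.
rewrite eqEcard card_imset // cardsT card_ord Ck leqnn andbT.
by apply/fintype.subsetP => _ /finset.imsetP[a _ ->].
Qed.

(* Ordered m-tuples of distinct blocks with enumerated elements are the
   injections of ['I_m * 'I_k] that send each row onto a block. *)
Lemma card_tuples_of_blocks (V : finType) (B : {set {set V}}) (k m : nat) :
  (0 < k)%N -> {in B, forall C : {set V}, #|C| = k} -> finset.trivIset B ->
  (#|B| ^_ m * k`! ^ m)%N =
  #|[pred F : {ffun 'I_m * 'I_k -> V} | injectiveb F &
      [forall i, (fun l => F (i, l)) @: [set: 'I_k] \in B]]|.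
Proof.
move=> k_gt0 cardB /finset.trivIsetP trivB.
pose row (F : {ffun 'I_m * 'I_k -> V}) : {ffun 'I_m -> {ffun 'I_k -> V}} :=
  [ffun i => [ffun l => F (i, l)]].
pose join (G : {ffun 'I_m -> {ffun 'I_k -> V}}) : {ffun 'I_m * 'I_k -> V} :=
  [ffun p => G p.1 p.2].
have rowK : cancel row join by move=> F; apply/ffunP => -[i l]; rewrite !ffunE.
have joinK : cancel join row.
  by move=> G; apply/ffunP => i; apply/ffunP => l; rewrite !ffunE.
pose blk (G : {ffun 'I_m -> {ffun 'I_k -> V}}) : {ffun 'I_m -> {set V}} :=
  [ffun i => G i @: [set: 'I_k]].
pose Q (c : {ffun 'I_m -> {set V}}) i :=
  [pred g : {ffun 'I_k -> V} | injectiveb g & g @: [set: 'I_k] == c i].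
pose C := [pred c : {ffun 'I_m -> {set V}} | c \in ffun_on (mem B) & injectiveb c].
have -> : #|[pred F : {ffun 'I_m * 'I_k -> V} | injectiveb F &
      [forall i, (fun l => F (i, l)) @: [set: 'I_k] \in B]]| =
    \sum_(G | (blk G \in C) && (G \in family (Q (blk G)))) 1.
  rewrite -sum1_card (reindex join) /=; last by exists row => F _.
  apply: eq_bigl => G; rewrite !inE -andbA.
  have imE i : [set join G (i, l) | l in [set: 'I_k]] = blk G i.
    by rewrite ffunE; apply: eq_imset => l; rewrite ffunE.
  have memblk i l : G i l \in blk G i by rewrite ffunE finset.imset_f.
  apply/andP/and3P => [[/injectiveP G_inj /forallP GB]|[/ffun_onP GB]].
    split; first by apply/ffun_onP => i; rewrite -imE.
      apply/injectiveP => i j blkij.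
      have := memblk i (Ordinal k_gt0).
      rewrite blkij ffunE => /finset.imsetP[l _ Gij].
      have := G_inj (i, Ordinal k_gt0) (j, l); rewrite !ffunE /= => /(_ Gij).
      by case.
    apply/familyP => i; rewrite !inE ffunE eqxx andbT; apply/injectiveP => a b Gab.
    by have := G_inj (i, a) (i, b); rewrite !ffunE /= => /(_ Gab) [].
  move=> /injectiveP blk_inj /familyP GQ; split; last first.
    by apply/forallP => i; rewrite imE.
  apply/injectiveP => -[i a] [j b]; rewrite !ffunE /= => Gij.
  have [ij|ij] := eqVneq i j.
    rewrite -{}ij in Gij *; congr pair.
    by have := GQ i; rewrite !inE => /andP[/injectiveP + _]; apply.
  have := trivB _ _ (GB i) (GB j); rewrite (inj_eq blk_inj) => /(_ ij).
  by move/pred0P/(_ (G i a)); rewrite /= memblk Gij memblk.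
(* The injections are grouped by the tuple of blocks that they enumerate: there are [#|B| ^_ m]
   injective tuples of blocks, each with [k! ^ m] enumerations. *)
rewrite (partition_big blk (mem C)) /=; last by move=> G /andP[].
rewrite -[m in _ ^_ m]card_ord -card_inj_ffuns_on -sum1_card big_distrl.
apply: eq_big => [c|c]; first by rewrite !inE.
rewrite inE => /andP[/ffun_onP cB c_inj].
rewrite /= mul1n.
transitivity #|family (Q c)|.
  rewrite card_family foldrE big_map big_enum /=.
  rewrite -[in LHS](card_ord m) -prod_nat_const; apply: eq_bigr => i _.
  by rewrite card_injective_image // cardB // cB.
rewrite -sum1_card; apply: eq_bigl => G.
apply/idP/idP => [GQ|/andP[/andP[_ GQ] /eqP <-]//].
have Gc : blk G = c.
  apply/ffunP => i; rewrite ffunE.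
  by have /familyP/(_ i) := GQ; rewrite !inE => /andP[_ /eqP].
by rewrite Gc eqxx GQ inE c_inj !andbT; apply/ffun_onP.
Qed.

(** A bit for every ordered pair makes the edge configurations a full product space, on which sums
    of products factorise without side conditions. *)
Definition graph_of (n : nat) (g : {ffun 'I_n * 'I_n -> bool}) : rel 'I_n :=
  fun i j => (i < j)%N && g (i, j) || (j < i)%N && g (j, i).

Lemma graph_of_sym n (g : {ffun 'I_n * 'I_n -> bool}) : symmetric (graph_of g).
Proof. by move=> i j; rewrite /graph_of orbC. Qed.

Definition graph_connected n (g : {ffun 'I_n * 'I_n -> bool}) : bool :=
  [forall a, forall b, connect (graph_of g) a b].

(* Pairs below the diagonal are sent below the diagonal, so that the map is
   injective on all ordered pairs, not only on the edges. *)
Definition pair_image k n (f : 'I_k -> 'I_n) (a : 'I_k * 'I_k) : 'I_n * 'I_n :=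
  if (a.1 < a.2)%N == (f a.1 < f a.2)%N then (f a.1, f a.2) else (f a.2, f a.1).

Lemma pair_image_lt k n (f : 'I_k -> 'I_n) a : injective f ->
  ((pair_image f a).1 < (pair_image f a).2)%N = (a.1 < a.2)%N.
Proof.
case: a => a b f_inj; rewrite /pair_image /=; case: ifP => [/eqP -> //|] /=.
have [->|ab] := eqVneq a b; first by rewrite !ltnn.
have : f a != f b by rewrite (inj_eq f_inj).
by rewrite neq_ltn; case: ltngtP => //= _ _; case: ltngtP.
Qed.

Lemma pair_image_mem k n (f : 'I_k -> 'I_n) a :
  ((pair_image f a).1 \in codom f) && ((pair_image f a).2 \in codom f).
Proof. by rewrite /pair_image; case: ifP => _ /=; rewrite !codom_f. Qed.

Lemma pair_image_inj k n (f : 'I_k -> 'I_n) : injective f ->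
  injective (pair_image f).
Proof.
move=> f_inj [a b] [c d] E.
have := pair_image_lt (a, b) f_inj; rewrite E pair_image_lt //=.
move: E; rewrite /pair_image /=; case: ifP => _; case: ifP => _;
  case=> /f_inj + /f_inj; move=> ? ?; subst => //;
  by case: ltngtP => // /val_inj ->.
Qed.

(** These are the pairs that must carry no edge if every row of [F] is to be a whole component:
    pairs between two different rows, and pairs from a row to a vertex outside the image. *)
Definition cross m k n (F : 'I_m * 'I_k -> 'I_n) (b : 'I_n * 'I_n) : bool :=
  ~~ [exists i, (b.1 \in codom (fun l => F (i, l))) &&
                (b.2 \in codom (fun l => F (i, l)))] &&
  ((b.1 \in codom F) || (b.2 \in codom F)).

Definition row_graph m k n (F : 'I_m * 'I_k -> 'I_n) (i : 'I_m)
    (g : {ffun 'I_n * 'I_n -> bool}) : {ffun 'I_k * 'I_k -> bool} :=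
  [ffun a => g (pair_image (fun l => F (i, l)) a)].

Lemma graph_of_row_graph m k n (F : 'I_m * 'I_k -> 'I_n) i g :
  injective F ->
  graph_of (row_graph F i g) =2 relpre (fun l => F (i, l)) (graph_of g).
Proof.
move=> F_inj a b; rewrite /graph_of /= !ffunE /pair_image /=.
have [->|ab] := eqVneq a b; first by rewrite !ltnn.
have : F (i, a) != F (i, b).
  by apply: contra ab => /eqP/F_inj[->].
rewrite neq_ltn; move: ab; rewrite neq_ltn.
by case: (ltngtP a b); case: (ltngtP (F (i, a)) (F (i, b))) => //=; rewrite ?orbF.
Qed.

(** Passing from sets of vertices to enumerated ones replaces the components by injections, which
    are easy to count and to relabel; [k! ^ m] is the number of enumerations. The two conditions on
    [g] concern disjoint sets of pairs, hence are independent for random edges. *)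
Lemma factorial_num_components n k m (g : {ffun 'I_n * 'I_n -> bool}) :
  (0 < k)%N ->
  (num_components (graph_of g) k ^_ m * k`! ^ m)%N =
  \sum_(F : {ffun 'I_m * 'I_k -> 'I_n} | injectiveb F)
    ([forall i, graph_connected (row_graph F i g)] &&
     [forall b : 'I_n * 'I_n, (b.1 < b.2)%N && cross F b ==> ~~ g b]).
Proof.
move=> k_gt0; have e_sym := graph_of_sym g.
have csym := sym_connect_sym e_sym.
have ceq : {in [set: 'I_n] & &, equivalence_rel (connect (graph_of g))}.
  by move=> x y z _ _ _; split=> [|xy]; [exact: connect0|exact: same_connect].
have /and3P[_ triv _] := equivalence_partitionP ceq.
rewrite /num_components card_tuples_of_blocks //; first last.
- apply/finset.trivIsetP => A B; rewrite !inE => /andP[+ _] /andP[+ _].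
  by move/finset.trivIsetP: triv; apply.
- by move=> C; rewrite inE => /andP[_ /eqP].
rewrite -sum1_card (eq_bigl (fun F : {ffun 'I_m * 'I_k -> 'I_n} =>
   injectiveb F && [forall i, (fun l => F (i, l)) @: [set: 'I_k] \in
      [set C in equivalence_partition (connect (graph_of g)) [set: 'I_n]
       | #|C : {set 'I_n}| == k] ])); last by move=> F; rewrite !inE.
rewrite big_mkcondr; apply: eq_bigr => F /injectiveP F_inj.
have rowF_inj i : injective (fun l => F (i, l)) by move=> a b /F_inj[].
have memrow i l : F (i, l) \in codom (fun l => F (i, l)).
  exact: (codom_f (fun l => F (i, l))).
apply: (congr1 nat_of_bool).
transitivity [forall i, graph_connected (row_graph F i g) &&
  [forall u, forall v, (u \in codom (fun l => F (i, l))) &&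
      (v \notin codom (fun l => F (i, l))) ==> ~~ graph_of g u v]].
  apply: eq_forallb => i; rewrite inE card_imset // cardsT card_ord eqxx andbT.
  rewrite component_image //; congr andb.
  apply: eq_forallb => a; apply: eq_forallb => b; apply: eq_connect => c d.
  by rewrite graph_of_row_graph.
apply/forallP/andP => [H|[/forallP H1 /forallP H2] i].
  split; first by apply/forallP => i; have /andP[] := H i.
  apply/forallP => -[u v] /=; apply/implyP => /andP[uv].
  rewrite /cross /= => /andP[/existsPn nuv /orP[/codomP|/codomP] [[i l] E]].
    have := nuv i; rewrite E memrow /= => vi.
    have /andP[_ /forallP/(_ u)/forallP/(_ v)] := H i.
    by rewrite vi E memrow /= /graph_of -E uv /= negb_or => /andP[].
  have := nuv i; rewrite andbC E memrow /= => ui.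
  have /andP[_ /forallP/(_ v)/forallP/(_ u)] := H i.
  by rewrite ui E memrow /= /graph_of -E uv /= orbC negb_or => /andP[].
rewrite H1 /=; apply/forallP => u; apply/forallP => v; apply/implyP.
move=> /andP[ui vi].
have crossuv : cross F (u, v).
  rewrite /cross /=; apply/andP; split; last first.
    by case/codomP: ui => l ->; rewrite codom_f.
  apply/existsPn => j; apply/negP => /andP[uj vj].
  case/codomP: ui uj vi => l -> /codomP[l' /F_inj[-> _]].
  by rewrite vj.
have crossvu : cross F (v, u).
  move: crossuv; rewrite /cross /= orbC => /andP[/existsPn nuv ->].
  by rewrite andbT; apply/existsPn => j; rewrite andbC.
have := H2 (u, v); have := H2 (v, u); rewrite /graph_of crossuv crossvu !andbT /=.
by case: ltngtP => //= _ H3 H4; rewrite ?orbF.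
Qed.

Local Open Scope classical_set_scope.
Local Open Scope ring_scope.

(** * Random graphs on fixed vertices *)

(** This is independence of disjoint groups of coordinates under a product weight. The total masses
    are kept general because the weights of the cross edges will be cut down to their value at
    [false]. *)
Lemma sum_prod_marginal (R : comNzRingType) (I A B : finType) (h : I * A -> B)
    (w : B -> bool -> R) (G : I -> {ffun A -> bool} -> R) : injective h ->
  \sum_(g : {ffun B -> bool})
     (\prod_b w b (g b)) * \prod_i G i [ffun a => g (h (i, a))] =
  (\prod_i \sum_(c : {ffun A -> bool}) (\prod_a w (h (i, a)) (c a)) * G i c) *
  \prod_(b | b \notin codom h) \sum_v w b v.
Proof.
move=> h_inj; rewrite bigA_distr_bigA /= big_distrl /=.
pose res (g : {ffun B -> bool}) : {ffun I -> {ffun A -> bool}} :=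
  [ffun i => [ffun a => g (h (i, a))]].
rewrite (partition_big res predT) //=; apply: eq_bigr => c _.
rewrite big_split /= mulrAC.
transitivity ((\sum_(g | res g == c) \prod_b w b (g b)) * \prod_i G i (c i)).
  rewrite big_distrl; apply: eq_bigr => g /eqP <- /=; congr (_ * _).
  by apply: eq_bigr => i _; rewrite ffunE.
congr (_ * _).
(* The fibre of [res] above [c] is again a product: the value at [b] is prescribed when [b] lies in
   the image of [h] and free otherwise. *)
pose Q b := [pred v | [forall i, forall a, (h (i, a) == b) ==> (v == c i a)]].
transitivity (\sum_(g in family Q) \prod_b w b (g b)).
  apply: eq_bigl => g; apply/eqP/familyP => [gc b|gQ].
    rewrite inE; apply/forallP => i; apply/forallP => a; apply/implyP.
    by move=> /eqP <-; rewrite -gc !ffunE.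
  apply/ffunP => i; apply/ffunP => a; rewrite !ffunE.
  have := gQ (h (i, a)); rewrite inE => /forallP/(_ i)/forallP/(_ a).
  by rewrite eqxx => /eqP.
rewrite -bigA_distr_big_dep (bigID (mem (codom h))) /=; congr (_ * _).
  rewrite -big_uniq /=; last by rewrite codomE map_inj_uniq ?enum_uniq.
  rewrite codomE big_map big_enum /=.
  rewrite pair_big /=; apply: eq_bigr => -[i a] _ /=.
  rewrite (big_pred1 (c i a)) // => v; apply/forallP/eqP.
    by move=> /(_ i)/forallP/(_ a); rewrite eqxx => /eqP.
  move=> -> j; apply/forallP => a'; apply/implyP => /eqP/h_inj[-> ->].
  exact: eqxx.
apply: eq_bigr => b bh; apply: eq_bigl => v; rewrite /=.
apply/forallP => i; apply/forallP => a; apply/implyP => /eqP E.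
by rewrite -E codom_f in bh.
Qed.

Section weights.
Variables (R : realDomainType) (T : Type) (phi : T -> T -> R).
Implicit Types n m k : nat.

(* The pairs below the diagonal carry no edge, so that the weights of all
   functions on ordered pairs sum to 1. *)
Definition edge_weight n (x : 'I_n -> T) (b : 'I_n * 'I_n) (v : bool) : R :=
  if (b.1 < b.2)%N then
    if v then phi (x b.1) (x b.2) else 1 - phi (x b.1) (x b.2)
  else (~~ v)%:R.

Definition graph_weight n (x : 'I_n -> T) (g : {ffun 'I_n * 'I_n -> bool}) : R :=
  \prod_b edge_weight x b (g b).

Definition conn_prob k (y : 'I_k -> T) : R :=
  \sum_(c : {ffun 'I_k * 'I_k -> bool}) graph_weight y c * (graph_connected c)%:R.

Definition cross_prob m k n (x : 'I_n -> T) (F : 'I_m * 'I_k -> 'I_n) : R :=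
  \prod_(b : 'I_n * 'I_n | (b.1 < b.2)%N && cross F b)
    (1 - phi (x b.1) (x b.2)).

Lemma sum_edge_weight n (x : 'I_n -> T) b : \sum_v edge_weight x b v = 1.
Proof.
by rewrite big_bool /edge_weight; case: ifP => _ /=; rewrite ?subrKC ?add0r.
Qed.

Hypothesis phi_sym : forall s t, phi s t = phi t s.

Lemma edge_weight_pair_image n k (x : 'I_n -> T) (f : 'I_k -> 'I_n) a v :
  injective f -> edge_weight x (pair_image f a) v = edge_weight (x \o f) a v.
Proof.
move=> f_inj; rewrite /edge_weight pair_image_lt // /pair_image.
by case: (_ == _) => //=; rewrite phi_sym.
Qed.

(* The requirement that cross edges are absent is absorbed into the weights of
   these edges before marginalising. *)
Lemma sum_graph_weight_components n m k (x : 'I_n -> T)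
    (F : {ffun 'I_m * 'I_k -> 'I_n}) : injective F ->
  \sum_g graph_weight x g *
    ([forall i, graph_connected (row_graph F i g)] &&
     [forall b : 'I_n * 'I_n, (b.1 < b.2)%N && cross F b ==> ~~ g b])%:R =
  (\prod_i conn_prob (fun l => x (F (i, l)))) * cross_prob x F.
Proof.
move=> F_inj.
have row_inj i : injective (fun l => F (i, l)) by move=> a b /F_inj[].
pose h (p : 'I_m * ('I_k * 'I_k)) := pair_image (fun l => F (p.1, l)) p.2.
have h_inj : injective h.
  move=> [i a] [j b]; rewrite /h /= => E.
  have ij : i = j.
    have /andP[/codomP[l +] _] := pair_image_mem (fun l => F (i, l)) a.
    have /andP[/codomP[l' +] _] := pair_image_mem (fun l => F (j, l)) b.
    by rewrite E => -> /F_inj[].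
  by move: E; rewrite -{}ij => /pair_image_inj -> //.
pose w b v := edge_weight x b v * (~~ ((b.1 < b.2)%N && cross F b && v))%:R.
have not_cross p : cross F (h p) = false.
  rewrite /cross; apply/negbTE; rewrite negb_and negbK; apply/orP; left.
  by apply/existsP; exists p.1; exact: (pair_image_mem (fun l => F (p.1, l))).
transitivity (\sum_(g : {ffun 'I_n * 'I_n -> bool}) (\prod_b w b (g b)) *
   \prod_i (graph_connected [ffun a => g (h (i, a))])%:R).
  apply: eq_bigr => g _; rewrite /w big_split /= -mulrA; congr (_ * _).
  have prodnat (J : finType) (P : pred J) :
      \prod_j ((P j)%:R : R) = [forall j, P j]%:R.
    apply/esym; have [/forallP PT|/forallPn[j nPj]] := boolP [forall j, P j].
      by rewrite big1 // => j _; rewrite PT.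
    by rewrite (bigD1 j) //= (negbTE nPj) mul0r.
  rewrite !prodnat -natrM mulnb andbC; congr (_ && _)%:R.
  by apply: eq_forallb => b; rewrite negb_and implybE.
rewrite (@sum_prod_marginal _ _ _ _ h w (fun i c => (graph_connected c)%:R)) //.
congr (_ * _).
  apply: eq_bigr => i _; apply: eq_bigr => c _; congr (_ * _).
  apply: eq_bigr => a _; rewrite /w not_cross andbF mulr1.
  by rewrite /h edge_weight_pair_image.
rewrite /cross_prob [LHS]big_mkcond [RHS]big_mkcond; apply: eq_bigr => b _ /=.
rewrite big_bool /w; case: ifPn => bh.
  case: ifP => /= /andP; rewrite ?andbT ?andbF ?mulr0 ?mulr1.
    by case=> bb _; rewrite add0r /edge_weight bb.
  by rewrite -(sum_edge_weight x b) big_bool.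
move: bh; rewrite negbK => /codomP[p ->]; rewrite not_cross andbF.
by [].
Qed.

Hypothesis phi01 : forall s t, 0 <= phi s t <= 1.

Lemma edge_weight_ge0 n (x : 'I_n -> T) b v : 0 <= edge_weight x b v.
Proof.
have /andP[phi0 phi1] := phi01 (x b.1) (x b.2).
by rewrite /edge_weight; case: ifP => _; [case: ifP; rewrite ?subr_ge0|].
Qed.

Lemma graph_weight_ge0 n (x : 'I_n -> T) g : 0 <= graph_weight x g.
Proof. by apply: prodr_ge0 => b _; exact: edge_weight_ge0. Qed.

Lemma sum_graph_weight n (x : 'I_n -> T) : \sum_g graph_weight x g = 1.
Proof.
rewrite -(bigA_distr_bigA (edge_weight x)) big1 // => b _.
exact: sum_edge_weight.
Qed.

Lemma conn_prob_ge0 k (y : 'I_k -> T) : 0 <= conn_prob y.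
Proof. by apply: sumr_ge0 => c _; rewrite mulr_ge0 ?graph_weight_ge0. Qed.

Lemma conn_prob_le1 k (y : 'I_k -> T) : conn_prob y <= 1.
Proof.
rewrite -(sum_graph_weight y); apply: ler_sum => c _.
by rewrite ler_piMr ?graph_weight_ge0 // lern1 leq_b1.
Qed.

Definition isolation_prob m k n (x : 'I_n -> T) (F : 'I_m * 'I_k -> 'I_n) : R :=
  \prod_(y | y \notin codom F) \prod_p (1 - phi (x (F p)) (x y)).

Lemma cross_prob_split m k n (x : 'I_n -> T) (F : 'I_m * 'I_k -> 'I_n) :
  injective F ->
  cross_prob x F = isolation_prob x F *
    \prod_(b : 'I_n * 'I_n | ((b.1 < b.2)%N && cross F b) &&
        ((b.1 \in codom F) && (b.2 \in codom F))) (1 - phi (x b.1) (x b.2)).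
Proof.
move=> F_inj; pose U := [pred u | u \in codom F].
rewrite /cross_prob
  (bigID (fun b : 'I_n * 'I_n => (b.1 \in codom F) && (b.2 \in codom F))) /=.
rewrite mulrC; congr (_ * _).
transitivity (\prod_(b : 'I_n * 'I_n | (b.1 \in U) && (b.2 \notin U))
   (1 - phi (x b.1) (x b.2))); last first.
  rewrite -(pair_big U (predC U) (fun u y => 1 - phi (x u) (x y))) /=.
  rewrite exchange_big /=; apply: eq_bigr => y _.
  rewrite -big_uniq /=; last by rewrite codomE map_inj_uniq ?enum_uniq.
  by rewrite codomE big_map big_enum.
rewrite [RHS](bigID (fun b : 'I_n * 'I_n => (b.1 < b.2)%N)) /=.
rewrite (bigID (fun b : 'I_n * 'I_n => b.1 \in U)) /=; congr (_ * _).
  apply: eq_bigl => -[u v]; rewrite /cross /= !inE.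
  have [ui|//] := boolP (u \in codom F); last by rewrite !andbF.
  have [vi|vi] := boolP (v \in codom F); rewrite ?andbF ?andbT //=.
  case: (_ < _)%N => //=; apply/existsPn => i; rewrite negb_and orbC.
  apply/orP; left; apply: contra vi => /codomP[l ->]; exact: codom_f.
(* A pair with exactly one endpoint in the image is listed on the left in increasing order, on the
   right with its inner endpoint first. The swap treats the pairs whose inner endpoint has the
   larger index. *)
pose sw (b : 'I_n * 'I_n) := (b.2, b.1).
have swK : involutive sw by case.
rewrite (reindex_inj (inv_inj swK)) /=; apply: eq_big => [[u v]|b _]; last first.
  by rewrite phi_sym.
rewrite /cross /= !inE.
have [ui|ui] := boolP (u \in codom F); have [vi|vi] := boolP (v \in codom F);
  rewrite ?andbF ?andbT //=.
have uv : u != v by apply: contra vi => /eqP <-.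
have -> : ~~ (u < v)%N = (v < u)%N by move: uv; rewrite neq_ltn; case: ltngtP.
case: (_ < _)%N => //=; apply/existsPn => i; rewrite negb_and.
apply/orP; left; apply: contra vi => /codomP[l ->]; exact: codom_f.
Qed.

Lemma isolation_prob_ge0 m k n (x : 'I_n -> T) (F : 'I_m * 'I_k -> 'I_n) :
  0 <= isolation_prob x F.
Proof.
apply: prodr_ge0 => y _; apply: prodr_ge0 => p _.
by rewrite subr_ge0; case/andP: (phi01 (x (F p)) (x y)).
Qed.

Lemma cross_prob_le m k n (x : 'I_n -> T) (F : 'I_m * 'I_k -> 'I_n) :
  injective F -> cross_prob x F <= isolation_prob x F.
Proof.
move=> F_inj; rewrite cross_prob_split //.
rewrite ler_piMr ?isolation_prob_ge0 //; apply: prodr_ile1 => b _.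
by rewrite subr_ge0 gerBl andbC phi01.
Qed.

Lemma cross_prob_ge m k n (x : 'I_n -> T) (F : 'I_m * 'I_k -> 'I_n) (q : R) :
  injective F -> (forall s t, phi s t <= q) -> 0 <= q <= 1 ->
  (1 - q) ^+ (m * k * (m * k)) * isolation_prob x F <= cross_prob x F.
Proof.
move=> F_inj phiq /andP[q0 q1]; rewrite cross_prob_split // mulrC.
rewrite ler_wpM2l ?isolation_prob_ge0 //.
pose U := [set u | u \in codom F]%SET.
have -> : (m * k * (m * k))%N = #|finset.setX U U|.
  by rewrite cardsX cardsE card_codom // card_prod !card_ord.
rewrite -prodr_const [X in X <= _]big_mkcond [X in _ <= X]big_mkcond /=.
apply: ler_prod => -[u v] _ /=; rewrite !inE /=.
case: (u \in codom F); case: (v \in codom F); rewrite ?andbF ?andbT ?ler01 ?lexx //=.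
rewrite subr_ge0 q1 /=; case: ifP => _; first by rewrite lerD2l lerN2.
by rewrite gerBl.
Qed.

End weights.

(** * Independent identically distributed points *)

Section sequence_space.
Context d (T : measurableType d).

Definition coordinate_sets : set (set (nat -> T)) :=
  \bigcup_i preimage_set_system [set: nat -> T] (fun x => x i) measurable.

(** One probability on infinite sequences serves all numbers of points at once, and all the blocks
    of points can be cut out of it. *)
Definition sequences := g_sigma_algebraType coordinate_sets.

Definition cylinder (s : seq nat) (A : nat -> set T) : set sequences :=
  [set x | forall i, i \in s -> A i (x i)].

Lemma measurable_coordinate i : measurable_fun [set: sequences] (fun x => x i).
Proof.
move=> _ A mA; apply: sub_sigma_algebra; exists i => //.
by exists A.
Qed.

Lemma measurable_into_sequences d' (T' : measurableType d')
    (f : T' -> sequences) :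
  (forall i, measurable_fun [set: T'] (fun w => f w i)) ->
  measurable_fun [set: T'] f.
Proof.
move=> mf; apply: (@measurability _ _ T' sequences setT f coordinate_sets) => //.
move=> _ [_ [i _ [A mA <-]] <-]; rewrite setTI.
by have := mf i measurableT A mA; rewrite !setTI.
Qed.

Lemma measurable_cylinder s A : (forall i, measurable (A i)) ->
  measurable (cylinder s A).
Proof.
move=> mA; have -> : cylinder s A =
    \bigcap_(i in [set` s]) ((fun x : sequences => x i) @^-1` A i).
  by apply/seteqP; split => x /= H i; apply: H.
apply: fin_bigcap_measurable => // i _.
by have := measurable_coordinate i measurableT (mA i); rewrite setTI.
Qed.

Lemma eq_measure_cylinders (R : realType)
    (m1 m2 : {measure set sequences -> \bar R}) :
  (m1 setT < +oo)%E ->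
  (forall n A, (forall i, measurable (A i)) ->
     m1 (cylinder (iota 0 n) A) = m2 (cylinder (iota 0 n) A)) ->
  forall B, measurable B -> m1 B = m2 B.
Proof.
move=> m1fin m12 B mB.
have mem_iota_lt n i : (i < n)%N -> i \in iota 0 n by rewrite mem_iota.
pose G : set (set sequences) := [set C | exists n, exists A,
  (forall i, measurable (A i)) /\ C = cylinder (iota 0 n) A].
apply: (measure_unique G (fun=> setT)) => //.
- apply/seteqP; split; last first.
    apply: smallest_sub; first exact: smallest_sigma_algebra.
    move=> _ [n [A [mA ->]]]; exact: measurable_cylinder.
  apply: smallest_sub; first exact: smallest_sigma_algebra.
  move=> _ [i _ [A mA <-]]; apply: sub_sigma_algebra.
  exists i.+1; exists (fun j => if j == i then A else setT); split.
    by move=> j; case: ifP.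
  rewrite setTI; apply/seteqP; split => x /= H.
    by move=> j _; case: eqP => // ->.
  by have := H i (mem_iota_lt _ _ (ltnSn i)); rewrite eqxx.
- move=> _ _ [n [A [mA ->]]] [n' [A' [mA' ->]]].
  exists (maxn n n'); exists (fun i => (if (i < n)%N then A i else setT) `&`
                                (if (i < n')%N then A' i else setT)); split.
    by move=> i; apply: measurableI; case: ifP.
  apply/seteqP; split => x /=.
    move=> [H H'] i ni; split; case: ifP => // ilt.
      exact: (H i (mem_iota_lt _ _ ilt)).
    exact: (H' i (mem_iota_lt _ _ ilt)).
  move=> H; split=> i; rewrite mem_iota add0n => /andP[_ ilt].
    have [|+ _] := H i; first by apply: mem_iota_lt; rewrite leq_max ilt.
    by rewrite ilt.
  have [|_ +] := H i; first by apply: mem_iota_lt; rewrite leq_max ilt orbT.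
  by rewrite ilt.
- move=> _; exists 0%N; exists (fun=> setT); split => //.
  by apply/seteqP; split.
- by apply/seteqP; split => // x _; exists 0%N.
- by move=> _ [n [A [mA ->]]]; exact: m12.
Qed.

End sequence_space.

Section iid.
Context d (T : measurableType d) (R : realType) (mu : probability T R).
Local Notation S := (sequences T).

Definition iid (nu : set S -> \bar R) : Prop :=
  forall s (A : nat -> set T), uniq s -> (forall i, measurable (A i)) ->
    nu (cylinder s A) = (\prod_(i <- s) mu (A i))%E.

(* Taking two independent copies of the sequence and reading each coordinate
   from a fresh place of one of them does not change the law; this one map gives
   both exchangeability and the independence of disjoint blocks. *)
Definition interleave (a : nat -> nat + nat) (xy : S * S) : S :=
  fun i => match a i with inl j => xy.1 j | inr j => xy.2 j end.

Lemma measurable_interleave a : measurable_fun [set: S * S] (interleave a).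
Proof.
apply: measurable_into_sequences => i; rewrite /interleave; case: (a i) => j.
  exact: (measurableT_comp (measurable_coordinate j) measurable_fst).
exact: (measurableT_comp (measurable_coordinate j) measurable_snd).
Qed.

HB.instance Definition _ a := isMeasurableFun.Build _ _ _ _ (interleave a)
  (measurable_interleave a).

Variables (nu : probability S R) (nu_iid : iid nu).

Lemma iid_reindex s (f : nat -> nat) (A : nat -> set T) :
  uniq s -> {in s &, injective f} -> (forall i, measurable (A i)) ->
  nu [set x | forall i, i \in s -> A i (x (f i))] = (\prod_(i <- s) mu (A i))%E.
Proof.
move=> us f_inj mA.
(* [g] inverts [f] on [s]; the default value is never reached there. *)
pose g j := head 0%N [seq i <- s | f i == j].
have gK i : i \in s -> g (f i) = i.
  move=> si; have : i \in [seq i' <- s | f i' == f i] by rewrite mem_filter eqxx.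
  rewrite /g; case E : [seq _ <- _ | _] => [//|i' r] _ /=.
  have : i' \in [seq i' <- s | f i' == f i] by rewrite E mem_head.
  by rewrite mem_filter => /andP[/eqP/f_inj + si']; apply.
transitivity (nu (cylinder (map f s) (A \o g))).
  congr (nu _); apply/seteqP; split => x /= H.
    by move=> _ /mapP[i si ->] /=; rewrite gK //; exact: H.
  by move=> i si; have := H (f i); rewrite /= gK //; apply; exact: map_f.
rewrite nu_iid; last by move=> i; exact: mA.
- by rewrite big_map big_seq [RHS]big_seq; apply: eq_bigr => i si /=; rewrite gK.
- by rewrite map_inj_in_uniq.
Qed.

Lemma interleave_iid a : injective a -> forall B, measurable B ->
  pushforward (nu \x nu)%E (interleave a) B = nu B.
Proof.
move=> a_inj B mB.
apply: (@eq_measure_cylinders _ _ _ (pushforward (nu \x nu)%E (interleave a))) => //.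
- rewrite /= /pushforward preimage_setT -setXTT product_measure1E //=.
  by rewrite !probability_setT mule1 ltry.
- move=> n A mA; apply/esym; transitivity (\prod_(i <- iota 0 n) mu (A i))%E.
    by apply: nu_iid => //; exact: iota_uniq.
  rewrite /= /pushforward; apply/esym.
  (* Splitting the coordinates by the copy from which they are read makes the preimage of a cylinder
     a rectangle. The index map [f] may take the same value in both copies, but injectivity of [a]
     makes it injective within each, which is all that [iid_reindex] asks for. *)
  pose isl i := if a i is inl _ then true else false.
  pose f i := match a i with inl j => j | inr j => j end.
  pose s1 := [seq i <- iota 0 n | isl i].
  pose s2 := [seq i <- iota 0 n | ~~ isl i].
  have -> : interleave a @^-1` cylinder (iota 0 n) A =
     [set x | forall i, i \in s1 -> A i (x (f i))] `*`
     [set x | forall i, i \in s2 -> A i (x (f i))].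
    apply/seteqP; split => -[x y] /=.
      move=> H; split => i; rewrite mem_filter => /andP[ai ni];
        have := H _ ni; rewrite /interleave /f; move: ai; rewrite /isl; by case: (a i).
    move=> [H1 H2] i ni; rewrite /interleave /=.
    have := H1 i; have := H2 i; rewrite !mem_filter ni !andbT /isl /f.
    by case: (a i) => j /= I1 I2; [exact: I2|exact: I1].
  have m (s : seq nat) : measurable [set x : S | forall i, i \in s -> A i (x (f i))].
    have -> : [set x : S | forall i, i \in s -> A i (x (f i))] =
      \bigcap_(i in [set` s]) ((fun x : S => x (f i)) @^-1` A i).
      by apply/seteqP; split => x /= H i; apply: H.
    apply: fin_bigcap_measurable => // i _.
    by have := measurable_coordinate (f i) measurableT (mA i); rewrite setTI.
  transitivity (nu [set x | forall i, i \in s1 -> A i (x (f i))] *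
     nu [set x | forall i, i \in s2 -> A i (x (f i))])%E.
    by apply: product_measure1E; exact: m.
  rewrite !iid_reindex ?filter_uniq ?iota_uniq //.
  + by rewrite !big_filter [RHS](bigID isl).
  + move=> i j; rewrite !mem_filter /isl /f => /andP[ai _] /andP[aj _].
    by case ei : (a i) ai => [//|i'] _; case ej : (a j) aj => [//|j'] _ ij;
      apply: a_inj; rewrite ei ej ij.
  + move=> i j; rewrite !mem_filter /isl /f => /andP[ai _] /andP[aj _].
    by case ei : (a i) ai => [i'|//] _; case ej : (a j) aj => [j'|//] _ ij;
      apply: a_inj; rewrite ei ej ij.
Qed.

Lemma ge0_integral_interleave (a : nat -> nat + nat) (f : S -> \bar R) : injective a ->
  measurable_fun [set: S] f -> (forall x, 0 <= f x)%E ->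
  (\int[nu]_x f x = \int[nu]_x \int[nu]_y f (interleave a (x, y)))%E.
Proof.
move=> a_inj mf f0.
transitivity (\int[pushforward (nu \x nu)%E (interleave a)]_x f x)%E.
  by apply: eq_measure_integral => B mB _; apply/esym/interleave_iid.
rewrite ge0_integral_pushforward //=.
rewrite preimage_setT (fubini_tonelli1 (f \o interleave a)) //.
  by apply: measurableT_comp => //; exact: measurable_interleave.
by move=> x; exact: f0.
Qed.

End iid.

Section bounded_functions.
Context d (Y : measurableType d) (R : realType) (P : probability Y R).
Implicit Type f g : Y -> R.

Lemma integrable_bounded f (c : R) : measurable_fun [set: Y] f ->
  (forall x, 0 <= f x <= c) -> P.-integrable [set: Y] (EFin \o f).
Proof.
move=> mf fc; apply: measurable_bounded_integrable => //.
  by rewrite [X in (X < _)%E]probability_setT ltry.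
exists c; split; first by rewrite num_real.
move=> M cM x _ /=; have /andP[f0 f1] := fc x.
by rewrite ger0_norm // (le_trans f1) // ltW.
Qed.

Lemma EFin_Rintegral_bounded f (c : R) : measurable_fun [set: Y] f ->
  (forall x, 0 <= f x <= c) -> (\int[P]_x f x)%:E = (\int[P]_x (f x)%:E)%E.
Proof.
move=> mf fc; rewrite /Rintegral fineK //.
exact: integrable_fin_num (integrable_bounded mf fc).
Qed.

Lemma Rintegral_bounds f (c : R) : measurable_fun [set: Y] f ->
  (forall x, 0 <= f x <= c) -> 0 <= \int[P]_x f x <= c.
Proof.
move=> mf fc; apply/andP; split.
  by apply: Rintegral_ge0 => x _; case/andP: (fc x).
rewrite -lee_fin (EFin_Rintegral_bounded mf fc).
apply: (@le_trans _ _ (\int[P]_x (c%:E))%E).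
  by apply: ge0_le_integral => //; [|exact/measurable_EFinP|]; move=> x _;
    rewrite lee_fin; case/andP: (fc x).
by rewrite integral_cst // [X in (_ * X)%E]probability_setT mule1.
Qed.

Lemma Rintegral_probability_cst (c : R) : \int[P]_x (fun=> c) x = c.
Proof. by rewrite Rintegral_cst // [X in fine X]probability_setT mulr1. Qed.

Lemma Rintegral_sum (I : Type) (r : seq I) (p : pred I) (h : I -> Y -> R) :
  (forall i, P.-integrable [set: Y] (EFin \o h i)) ->
  \int[P]_x (\sum_(i <- r | p i) h i x) = \sum_(i <- r | p i) \int[P]_x h i x.
Proof.
move=> inth; rewrite -big_filter; under eq_Rintegral do rewrite -big_filter.
elim: [seq _ <- _ | _] => [|i s IHs].
  rewrite big_nil; under eq_Rintegral do rewrite big_nil.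
  exact: Rintegral_probability_cst.
rewrite big_cons -IHs -RintegralD //.
  by apply: eq_Rintegral => x _; rewrite big_cons.
rewrite (_ : _ \o _ = fun x => (\sum_(j <- s) (h j x)%:E)%E); last first.
  by apply/funext => x /=; rewrite sumEFin.
by apply: integrable_sum => // j _; exact: inth.
Qed.

End bounded_functions.

Section iid_integrals.
Context d (T : measurableType d) (R : realType) (mu : probability T R).
Local Notation S := (sequences T).
Variables (nu : probability S R) (nu_iid : iid mu nu).
Implicit Type f : S -> R.

Lemma measurable_section d1 d2 (Y1 : measurableType d1) (Y2 : measurableType d2)
    (g : Y1 * Y2 -> R) x : measurable_fun [set: Y1 * Y2] g ->
  measurable_fun [set: Y2] (fun y => g (x, y)).
Proof. by move=> mg; apply: measurableT_comp => //; exact: measurable_pair1. Qed.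

Lemma measurable_Rintegral_snd (g : S * S -> R) (c : R) :
  measurable_fun [set: S * S] g -> (forall z, 0 <= g z <= c) ->
  measurable_fun [set: S] (fun x => \int[nu]_y g (x, y)).
Proof.
move=> mg gc; apply/measurable_EFinP.
rewrite (_ : _ \o _ = fun x => (\int[nu]_y (g (x, y))%:E)%E); last first.
  apply/funext => x /=; apply: EFin_Rintegral_bounded => //.
  exact: measurable_section.
apply: (@measurable_fun_fubini_tonelli_F _ _ _ _ _ nu (EFin \o g)).
  exact/measurable_EFinP.
by move=> z; rewrite lee_fin; case/andP: (gc z).
Qed.

Lemma Rintegral_interleave (a : nat -> nat + nat) f (c : R) : injective a ->
  measurable_fun [set: S] f -> (forall x, 0 <= f x <= c) ->
  \int[nu]_x f x = \int[nu]_x \int[nu]_y f (interleave a (x, y)).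
Proof.
move=> a_inj mf fc; apply: EFin_inj.
have mfa : measurable_fun [set: S * S] (f \o interleave a).
  by apply: measurableT_comp => //; exact: measurable_interleave.
rewrite (EFin_Rintegral_bounded _ mf fc) (ge0_integral_interleave nu_iid a_inj); first last.
- by move=> x; rewrite lee_fin; case/andP: (fc x).
- exact/measurable_EFinP.
have fac x y : 0 <= f (interleave a (x, y)) <= c by exact: fc.
have msec x := measurable_section x mfa.
rewrite (@EFin_Rintegral_bounded _ _ _ _ _ c).
- by apply: eq_integral => x _; rewrite (EFin_Rintegral_bounded _ (msec x) (fac x)).
- exact: measurable_Rintegral_snd mfa (fun z => fc _).
- by move=> x; exact: Rintegral_bounds (msec x) (fac x).
Qed.

Lemma Rintegral_prod_coordinates (w : T -> R) (s : seq nat) :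
  measurable_fun [set: T] w -> (forall t, 0 <= w t <= 1) -> uniq s ->
  \int[nu]_y (\prod_(j <- s) w (y j)) = (\int[nu]_y w (y 0%N)) ^+ size s.
Proof.
move=> mw w01; elim: s => [|j s IHs] /=.
  by move=> _; under eq_Rintegral do rewrite big_nil;
    exact: Rintegral_probability_cst.
case/andP => js us.
have prod01 (r : seq nat) (y : S) : 0 <= \prod_(i <- r) w (y i) <= 1.
  apply/andP; split; first by apply: prodr_ge0 => i _; case/andP: (w01 (y i)).
  by apply: prodr_ile1 => i _; exact: w01.
have mprod (r : seq nat) : measurable_fun [set: S] (fun y => \prod_(i <- r) w (y i)).
  apply: measurable_prod => i _; apply: measurableT_comp => //.
  exact: measurable_coordinate.
(* Coordinate [j] is read from place 0 of the first copy, all the others from their own place in the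
   second. As [j] is not in [s], the product over [s] sees the second copy only. *)
pose a i : nat + nat := if i == j then inl 0%N else inr i.
have a_inj : injective a.
  move=> i1 i2; rewrite /a; case: eqP => [->|_]; case: eqP => [->|_] //.
  by case.
rewrite (Rintegral_interleave a_inj (mprod _) (prod01 _)).
have inner x : \int[nu]_y (\prod_(i <- j :: s) w (interleave a (x, y) i)) =
    w (x 0%N) * (\int[nu]_y w (y 0%N)) ^+ size s.
  rewrite -IHs // -RintegralZl //; last first.
    exact: integrable_bounded (mprod s) (prod01 s).
  apply: eq_Rintegral => y _; rewrite big_cons {1}/interleave /a eqxx /=.
  congr (_ * _); rewrite big_seq [RHS]big_seq; apply: eq_bigr => i si.
  by rewrite /interleave; case: eqP si js => [->|//] ->.
under eq_Rintegral do rewrite inner.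
rewrite RintegralZr ?exprS //; apply: (@integrable_bounded _ _ _ _ _ 1) => //.
apply: measurableT_comp => //; exact: measurable_coordinate.
Qed.

Lemma measurable_relabel (f : nat -> nat) :
  measurable_fun [set: S] ((fun x l => x (f l)) : S -> S).
Proof. by apply: measurable_into_sequences => l; exact: measurable_coordinate. Qed.

Lemma Rintegral_prod_blocks k m (r : S -> R) (c : R) :
  measurable_fun [set: S] r -> (forall x, 0 <= r x <= c) ->
  (forall x y : S, (forall l, (l < k)%N -> x l = y l) -> r x = r y) ->
  \int[nu]_x (\prod_(i < m) r (fun l => x (i * k + l)%N)) =
  (\int[nu]_x r x) ^+ m.
Proof.
move=> mr rc r_loc.
have mshift i : measurable_fun [set: S] (fun x => r (fun l => x (i * k + l)%N)).
  by apply: (measurableT_comp mr (measurable_relabel (fun l => i * k + l)%N)).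
have mprod m' : measurable_fun [set: S]
    (fun x => \prod_(i < m') r (fun l => x (i * k + l)%N)).
  by apply: measurable_prod => i _; exact: mshift.
have prodc m' (x : S) : 0 <= \prod_(i < m') r (fun l => x (i * k + l)%N) <= c ^+ m'.
  apply/andP; split.
    by apply: prodr_ge0 => i _; case/andP: (rc (fun l => x (i * k + l)%N)).
  rewrite -[X in _ ^+ X]card_ord -prodr_const; apply: ler_prod => i _; exact: rc.
elim: m => [|m IHm].
  by under eq_Rintegral do rewrite big_ord0;
    exact: Rintegral_probability_cst.
(* The first block is read from the first copy, the rest from the second, shifted back by [k] so
   that the product over the remaining [m] blocks reappears. Locality of [r] is what allows the
   first factor to ignore the second copy. *)
pose a i : nat + nat := if (i < k)%N then inl i else inr (i - k)%N.
have a_inj : injective a.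
  move=> i1 i2; rewrite /a; case: ltnP => i1k; case: ltnP => i2k //; first by case.
  by case=> /(congr1 (addn^~ k)); rewrite !subnK.
rewrite (Rintegral_interleave a_inj (mprod _) (prodc _)).
have inner (x : S) :
    \int[nu]_y (\prod_(i < m.+1) r (fun l => interleave a (x, y) (i * k + l)%N)) =
    r x * (\int[nu]_y r y) ^+ m.
  rewrite -IHm // -RintegralZl //; last first.
    exact: integrable_bounded (mprod m) (prodc m).
  apply: eq_Rintegral => y _; rewrite big_ord_recl /=; congr (_ * _).
    by apply: r_loc => l lk; rewrite /interleave /a mul0n lk.
  apply: eq_bigr => i _; congr r; apply/funext => l; rewrite /interleave /a.
  by rewrite /bump /= add1n mulSn -addnA ltnNge leq_addr /= addKn.
under eq_Rintegral do rewrite inner.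
by rewrite RintegralZr ?exprS //; exact: integrable_bounded mr rc.
Qed.

End iid_integrals.

(** * Component counts given the number of points *)

Section component_integrals.
Context d (T : measurableType d) (R : realType) (mu : probability T R).
Local Notation S := (sequences T).
Variables (nu : probability S R) (nu_iid : iid mu nu).
Variables (phi : T -> T -> R) (phi_conn : connection_function phi).

Let phi01 s t : 0 <= phi s t <= 1.
Proof. by case: phi_conn => _ _; exact. Qed.

Let phi_sym s t : phi s t = phi t s.
Proof. by case: phi_conn => _ H _; exact: H. Qed.

(* The i-th of the m groups of k points is [x (i * k)], ..., [x (i * k + k - 1)]. *)
Definition conn_blocks m k (x : S) : R :=
  \prod_(i < m) conn_prob phi (fun l : 'I_k => x (i * k + l)%N).

Definition avoid m k (x : S) (t : T) : R :=
  \prod_(p : 'I_m * 'I_k) (1 - phi (x (p.1 * k + p.2)%N) t).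

(* Integrals against [mu] are written as integrals against [nu] of a function
   of the coordinate 0. *)
Definition mean_avoid m k (x : S) : R := \int[nu]_y avoid m k x (y 0%N).

Lemma measurable_phi d' (Y : measurableType d') (f g : Y -> T) :
  measurable_fun [set: Y] f -> measurable_fun [set: Y] g ->
  measurable_fun [set: Y] (fun y => phi (f y) (g y)).
Proof.
move=> mf mg; case: phi_conn => mphi _ _.
exact: (measurableT_comp mphi (measurable_fun_pair mf mg)).
Qed.

Lemma measurable_edge_weight n (x : 'I_n -> nat) b v :
  measurable_fun [set: S] (fun y : S => edge_weight phi (y \o x) b v).
Proof.
have mphi : measurable_fun [set: S] (fun y : S => phi (y (x b.1)) (y (x b.2))).
  by apply: measurable_phi; exact: measurable_coordinate.
rewrite /edge_weight; case: (b.1 < b.2)%N; last exact: measurable_cst.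
by case: v => //=; apply: measurable_funB => //; exact: measurable_cst.
Qed.

Lemma measurable_graph_weight n (x : 'I_n -> nat) g :
  measurable_fun [set: S] (fun y : S => graph_weight phi (y \o x) g).
Proof.
by apply: measurable_prod => b _; exact: measurable_edge_weight.
Qed.

Lemma measurable_conn_prob k (x : 'I_k -> nat) :
  measurable_fun [set: S] (fun y : S => conn_prob phi (y \o x)).
Proof.
apply: measurable_sum => c; apply: measurable_funM; last exact: measurable_cst.
exact: measurable_graph_weight.
Qed.

Lemma measurable_conn_blocks m k : measurable_fun [set: S] (conn_blocks m k).
Proof. by apply: measurable_prod => i _; exact: measurable_conn_prob. Qed.

Lemma conn_blocks01 m k x : 0 <= conn_blocks m k x <= 1.
Proof.
apply/andP; split; first by apply: prodr_ge0 => i _; exact: conn_prob_ge0.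
by apply: prodr_ile1 => i _; rewrite conn_prob_ge0 ?conn_prob_le1.
Qed.

Let cphi01 s t : 0 <= 1 - phi s t <= 1.
Proof. by rewrite subr_ge0 gerBl andbC phi01. Qed.

Lemma avoid01 m k x t : 0 <= avoid m k x t <= 1.
Proof.
apply/andP; split; last by apply: prodr_ile1 => p _; exact: cphi01.
by apply: prodr_ge0 => p _; case/andP: (cphi01 (x (p.1 * k + p.2)%N) t).
Qed.

Lemma measurable_avoid m k :
  measurable_fun [set: S * S] (fun xy => avoid m k xy.1 (xy.2 0%N)).
Proof.
apply: measurable_prod => p _; apply: measurable_funB; first exact: measurable_cst.
apply: measurable_phi.
  exact: (measurableT_comp (measurable_coordinate _) measurable_fst).
exact: (measurableT_comp (measurable_coordinate _) measurable_snd).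
Qed.

Lemma measurable_avoid_pt m k x : measurable_fun [set: T] (avoid m k x).
Proof.
apply: measurable_prod => p _; apply: measurable_funB; first exact: measurable_cst.
by apply: measurable_phi; [exact: measurable_cst|exact: measurable_id].
Qed.

Lemma measurable_mean_avoid m k : measurable_fun [set: S] (mean_avoid m k).
Proof.
apply: (@measurable_Rintegral_snd _ _ _ nu _ 1 (measurable_avoid m k)) => z.
exact: avoid01.
Qed.

Lemma mean_avoid01 m k x : 0 <= mean_avoid m k x <= 1.
Proof.
apply: Rintegral_bounds => [|y]; last exact: avoid01.
exact: (measurable_section x (measurable_avoid m k)).
Qed.

Definition conn_rows n m k (F : {ffun 'I_m * 'I_k -> 'I_n}) (x : S) : R :=
  \prod_i conn_prob phi (fun l => x (F (i, l))).

Lemma conn_rows01 n m k (F : {ffun 'I_m * 'I_k -> 'I_n}) x :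
  0 <= conn_rows F x <= 1.
Proof.
apply/andP; split; first by apply: prodr_ge0 => i _; exact: conn_prob_ge0.
by apply: prodr_ile1 => i _; rewrite conn_prob_ge0 ?conn_prob_le1.
Qed.

Lemma measurable_conn_rows n m k (F : {ffun 'I_m * 'I_k -> 'I_n}) :
  measurable_fun [set: S] (conn_rows F).
Proof. by apply: measurable_prod => i _; exact: measurable_conn_prob. Qed.

Lemma measurable_isolation_prob n m k (F : {ffun 'I_m * 'I_k -> 'I_n}) :
  measurable_fun [set: S]
    (fun x : S => isolation_prob phi (fun i : 'I_n => x i) F).
Proof.
apply: (eq_measurable_fun (fun x : S => \prod_(y <- enum [predC codom F])
    \prod_p (1 - phi (x (F p)) (x y)))).
  by move=> x _; rewrite /isolation_prob big_enum; apply: eq_bigl => y; rewrite inE.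
apply: measurable_prod => y _; apply: measurable_prod => p _.
apply: measurable_funB; first exact: measurable_cst.
by apply: measurable_phi; exact: measurable_coordinate.
Qed.

Lemma measurable_cross_prob n m k (F : {ffun 'I_m * 'I_k -> 'I_n}) :
  measurable_fun [set: S]
    (fun x : S => cross_prob phi (fun i : 'I_n => x i) F).
Proof.
pose r := enum [pred b : 'I_n * 'I_n | (b.1 < b.2)%N && cross F b].
apply: (eq_measurable_fun (fun x : S => \prod_(b <- r)
  (1 - phi (x b.1) (x b.2)))).
  by move=> x _; rewrite /cross_prob big_enum.
apply: measurable_prod => b _; apply: measurable_funB; first exact: measurable_cst.
by apply: measurable_phi; exact: measurable_coordinate.
Qed.

Let isolation01 n m k (F : {ffun 'I_m * 'I_k -> 'I_n}) (x : S) :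
  0 <= isolation_prob phi (fun i : 'I_n => x i) F <= 1.
Proof.
rewrite isolation_prob_ge0 //=; apply: prodr_ile1 => y _; apply/andP; split.
  by apply: prodr_ge0 => p _; case/andP: (cphi01 (x (F p)) (x y)).
by apply: prodr_ile1 => p _; exact: cphi01.
Qed.

Let conn_rows_mul01 n m k (F : {ffun 'I_m * 'I_k -> 'I_n}) (x : S) (a : R) :
  0 <= a <= 1 -> 0 <= conn_rows F x * a <= 1.
Proof.
have /andP[c0 c1] := conn_rows01 F x; move=> /andP[a0 a1].
by rewrite mulr_ge0 //= mulr_ile1.
Qed.

(** Exchangeability makes the integral the same for all injections: [a] reads the point [F (i, l)]
    from the standard place [i * k + l] of the first copy and every other point from the second.
    With the first copy fixed, the [n - m * k] other points are independent, and each avoids the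
    groups with probability [mean_avoid]. *)
Lemma Rintegral_isolated n m k (F : {ffun 'I_m * 'I_k -> 'I_n}) :
  injective F ->
  \int[nu]_x (conn_rows F x * isolation_prob phi (fun i : 'I_n => x i) F) =
  \int[nu]_x (conn_blocks m k x * mean_avoid m k x ^+ (n - m * k)).
Proof.
move=> F_inj.
pose a (j : nat) : nat + nat :=
  if [pick p | F p == j :> nat] is Some p then inl (p.1 * k + p.2)%N else inr j.
have aF p : a (F p) = inl (p.1 * k + p.2)%N.
  rewrite /a; case: pickP => [q /eqP/val_inj/F_inj -> //|/(_ p)].
  by rewrite eqxx.
have aN (y : 'I_n) : y \notin codom F -> a y = inr (y : nat).
  rewrite /a; case: pickP => // p /eqP/val_inj <-.
  by rewrite codom_f.
have a_inj : injective a.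
  move=> i j; rewrite /a; case: pickP => [p /eqP <-|_]; case: pickP => [q /eqP <-|_] //.
    (* The pair is recovered from [p.1 * k + p.2] by Euclidean division by [k], which is positive
       because 'I_k has an element. *)
    case=> E; congr (F _ : nat); case: p q E => [p1 p2] [q1 q2] /= E.
    have k_gt0 : (0 < k)%N by apply: leq_ltn_trans (ltn_ord p2).
    have E1 := congr1 (divn^~ k) E; have E2 := congr1 (modn^~ k) E.
    move: E1 E2 => /=; rewrite !modnMDl !modn_small // !divnMDl // !divn_small //.
    by rewrite !addn0 => /val_inj -> /val_inj ->.
  by case.
rewrite (Rintegral_interleave nu_iid a_inj (measurable_funM
  (measurable_conn_rows F) (measurable_isolation_prob F))
  (fun x => conn_rows_mul01 F x (isolation01 F x))).
apply: eq_Rintegral => x _.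
transitivity (\int[nu]_y (conn_blocks m k x *
   \prod_(j <- [seq val y | y <- enum [predC codom F]]) avoid m k x (y j))).
  apply: eq_Rintegral => y _; rewrite /conn_rows /conn_blocks; congr (_ * _).
    apply: eq_bigr => i _; congr conn_prob; apply/funext => l.
    by rewrite /interleave aF.
  rewrite big_map big_enum_cond /isolation_prob /=.
  apply: eq_big => [j|j jF]; first by rewrite inE andbT.
  by apply: eq_bigr => p _; rewrite /interleave aF aN.
have us : uniq [seq val y | y <- enum [predC codom F]].
  by rewrite map_inj_uniq ?enum_uniq //; exact: val_inj.
rewrite RintegralZl //; last first.
  apply: (@integrable_bounded _ _ _ _ _ 1).
    apply: measurable_prod => j _; apply: measurableT_comp.
      exact: measurable_avoid_pt.
    exact: measurable_coordinate.
  move=> y; apply/andP; split; last by apply: prodr_ile1 => j _; exact: avoid01.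
  by apply: prodr_ge0 => j _; case/andP: (avoid01 m k x (y j)).
congr (_ * _).
rewrite (Rintegral_prod_coordinates nu_iid (measurable_avoid_pt m k x)) //.
- rewrite size_map -cardE; congr (_ ^+ _).
  have := cardC (mem (codom F)); rewrite card_codom // card_prod !card_ord => nE.
  by rewrite -[X in (X - _)%N]nE addKn.
- by move=> t; exact: avoid01.
Qed.

Definition blocks_integral m k n : R :=
  \int[nu]_x (conn_blocks m k x * mean_avoid m k x ^+ (n - m * k)).

(** This is [k! ^ m] times the m-th factorial moment of the number of components of size [k] for
    exactly [n] independent points. *)
Definition graph_moment m k n : R :=
  \int[nu]_x (\sum_(g : {ffun 'I_n * 'I_n -> bool})
    graph_weight phi (fun i : 'I_n => x i) g *
      (num_components (graph_of g) k ^_ m * k`! ^ m)%:R).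

Lemma graph_moment_bounds m k n (q : R) : (0 < k)%N ->
  (forall s t, phi s t <= q) -> 0 <= q <= 1 ->
  (1 - q) ^+ (m * k * (m * k)) * ((n ^_ (m * k))%:R * blocks_integral m k n)
    <= graph_moment m k n <= (n ^_ (m * k))%:R * blocks_integral m k n.
Proof.
move=> k_gt0 phiq q01.
pose f (F : {ffun 'I_m * 'I_k -> 'I_n}) (x : S) :=
  conn_rows F x * cross_prob phi (fun i : 'I_n => x i) F.
pose g (F : {ffun 'I_m * 'I_k -> 'I_n}) (x : S) :=
  conn_rows F x * isolation_prob phi (fun i : 'I_n => x i) F.
have intf F : nu.-integrable setT (EFin \o f F).
  apply: (@integrable_bounded _ _ _ _ _ 1).
    exact: measurable_funM (measurable_conn_rows F) (measurable_cross_prob F).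
  move=> x; apply: conn_rows_mul01; apply/andP; split.
    by apply: prodr_ge0 => b _; case/andP: (cphi01 (x b.1) (x b.2)).
  by apply: prodr_ile1 => b _; exact: cphi01.
have intg F : nu.-integrable setT (EFin \o g F).
  apply: (@integrable_bounded _ _ _ _ _ 1).
    exact: measurable_funM (measurable_conn_rows F) (measurable_isolation_prob F).
  by move=> x; exact: conn_rows_mul01.
have c0 F x : 0 <= conn_rows F x by case/andP: (conn_rows01 F x).
have -> : graph_moment m k n =
    \sum_(F : {ffun 'I_m * 'I_k -> 'I_n} | injectiveb F) \int[nu]_x f F x.
  rewrite -Rintegral_sum //; apply: eq_Rintegral => x _.
  transitivity (\sum_(F : {ffun 'I_m * 'I_k -> 'I_n} | injectiveb F)
     \sum_(g : {ffun 'I_n * 'I_n -> bool})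
     graph_weight phi (fun i : 'I_n => x i) g *
     ([forall i, graph_connected (row_graph F i g)] &&
     [forall b : 'I_n * 'I_n, (b.1 < b.2)%N && cross F b ==> ~~ g b])%:R).
    rewrite exchange_big /=; apply: eq_bigr => c _.
    by rewrite factorial_num_components // natr_sum mulr_sumr.
  by apply: eq_bigr => F /injectiveP F_inj; rewrite sum_graph_weight_components.
(* All injections contribute the same integral, and there are [n ^_ (m * k)] of them. *)
have sumg : \sum_(F : {ffun 'I_m * 'I_k -> 'I_n} | injectiveb F) \int[nu]_x g F x =
    (n ^_ (m * k))%:R * blocks_integral m k n.
  rewrite (eq_bigr (fun=> blocks_integral m k n)); last first.
    by move=> F /injectiveP F_inj; rewrite Rintegral_isolated.
  rewrite sumr_const mulr_natl; congr (_ *+ _).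
  have := card_inj_ffuns (('I_m * 'I_k)%type : finType) 'I_n.
  rewrite card_prod !card_ord => <-; apply: eq_card => F; by rewrite !inE.
rewrite -sumg mulr_sumr; apply/andP; split; apply: ler_sum => F /injectiveP F_inj.
  rewrite -RintegralZl //; apply: le_Rintegral => //.
    by apply: eq_integrable (integrableZl _ ((1 - q) ^+ (m * k * (m * k))) (intg F)).
  move=> x _; rewrite /f /g mulrCA ler_wpM2l //; exact: cross_prob_ge.
apply: le_Rintegral => // x _; rewrite /f /g ler_wpM2l //.
exact: cross_prob_le.
Qed.

End component_integrals.

(** * Moments of the component count through the law of the points *)

Section law_of_points.
Context d (T : measurableType d) (R : realType) (mu : probability T R).
Context d' (Omega : measurableType d') (P : probability Omega R).
Variable X : nat -> {RV P >-> T}.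
Local Notation S := (sequences T).

Definition points (w : Omega) : S := fun i => X i w.

Lemma measurable_points : measurable_fun [set: Omega] points.
Proof. by apply: measurable_into_sequences => i; exact: measurable_funPT. Qed.

HB.instance Definition _ := isMeasurableFun.Build _ _ _ _ points measurable_points.

Definition law_of_points : probability S R :=
  distribution P (points : {RV P >-> S}).

Lemma sigma_of_points_preimage (B : set S) : measurable B ->
  sigma_of_points X [set: nat] (points @^-1` B).
Proof.
move=> mB; pose G := [set B : set S | sigma_of_points X [set: nat] (points @^-1` B)].
suff : <<s @coordinate_sets _ T >> `<=` G by apply; exact: mB.
apply: smallest_sub.
  split.
  - by rewrite /G /= preimage_set0; exact: sigma_algebra0.
  - by move=> A GA; rewrite /G /= setTD -preimage_setC -setTD; exact: sigma_algebraCD.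
  - by move=> A GA; rewrite /G /= preimage_bigcup; exact: sigma_algebra_bigcup.
move=> _ [i _ [A mA <-]]; apply: sub_sigma_algebra; exists i => //.
by exists A => //; rewrite !setTI.
Qed.

Hypothesis X_law : forall i, has_law (X i) mu.
Hypothesis X_indep : mutually_independent X.

Lemma law_of_points_iid : iid mu law_of_points.
Proof.
move=> s A us mA.
have := X_indep [fset i in s]%fset mA.
rewrite (_ : \bigcap_(i in _) _ = points @^-1` cylinder s A); last first.
  by apply/seteqP; split => w /= H i; have := H i; rewrite /= !inE /=; exact.
move=> PE; transitivity (P (points @^-1` cylinder s A)) => //.
rewrite PE (perm_big s) /=.
  by apply: eq_bigr => i _; have := X_law i (mA i).
by apply: uniq_perm; rewrite ?fset_uniq // => i; rewrite !inE.
Qed.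

Variable N : {RV P >-> nat}.
Hypothesis N_indep : independent_of_points N X.

Lemma integral_points_given_size n (h : S -> R) (c : R) :
  measurable_fun [set: S] h -> (forall x, 0 <= h x <= c) ->
  (\int[P]_(w in N @^-1` [set n]) (h (points w))%:E =
   P (N @^-1` [set n]) * (\int[law_of_points]_x h x)%:E)%E.
Proof.
move=> mh hc.
have mN : measurable (N @^-1` [set n]) by exact: measurable_funPTI.
have h0 x : (0 <= (h x)%:E)%E by rewrite lee_fin; case/andP: (hc x).
have mhE : measurable_fun [set: S] (EFin \o h) by exact/measurable_EFinP.
rewrite (EFin_Rintegral_bounded _ mh hc).
(* The integral over the event that [N] equals [n] is taken for the restricted measure, to which the
   event's complement is negligible. Independence says that this measure, pushed forward by
   [points], is the law of the points times the probability of the event. *)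
transitivity (\int[pushforward (mrestr P mN) points]_x (h x)%:E)%E.
  rewrite ge0_integral_pushforward //= preimage_setT.
  rewrite (ge0_negligible_integral (measurableC mN) measurableT); first last.
  - by rewrite /= /mrestr setICl measure0.
  - by move=> w _ /=; exact: h0.
  - exact: (measurableT_comp mhE measurable_points).
  rewrite setTD setCK; apply: eq_measure_integral => B mB BN.
  by rewrite /= /mrestr setIidl.
have pN : 0 <= fine (P (N @^-1` [set n])) by exact: fine_ge0.
transitivity (\int[mscale (NngNum pN) law_of_points]_x (h x)%:E)%E.
  apply: eq_measure_integral => B mB _.
  rewrite /= /mscale /= /pushforward /mrestr fineK ?fin_num_measure //.
  rewrite setIC N_indep //; exact: sigma_of_points_preimage.
by rewrite ge0_integral_mscale //= fineK ?fin_num_measure.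
Qed.

Variables (phi : T -> T -> R) (phi_conn : connection_function phi).
Variable E : nat -> nat -> {RV P >-> bool}.
Hypothesis E_graph : random_connection_graph phi X N E.

(** The mask clears the bits that [E] leaves unspecified, in agreement with [edge_weight], which
    gives weight 0 to any bit set outside the pairs [i < j]. *)
Definition edge_graph n (w : Omega) : {ffun 'I_n * 'I_n -> bool} :=
  [ffun b : 'I_n * 'I_n => (b.1 < b.2)%N && E b.1 b.2 w].

Lemma edge_graph_prob n (g : {ffun 'I_n * 'I_n -> bool}) :
  P (N @^-1` [set n] `&` [set w | edge_graph n w = g]) =
  (\int[P]_(w in N @^-1` [set n])
     (graph_weight phi (fun i : 'I_n => points w i) g)%:E)%E.
Proof.
have [/forallP low|/forallPn[b]] :=
    boolP [forall b : 'I_n * 'I_n, (b.1 < b.2)%N || ~~ g b]; last first.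
  rewrite negb_or negbK => /andP[b12 gb].
  rewrite (_ : _ `&` _ = set0); last first.
    apply/seteqP; split => // w [_ /= /ffunP/(_ b)]; rewrite ffunE gb.
    by rewrite (negbTE b12).
  rewrite measure0 integral0_eq // => w _; congr (_%:E).
  by rewrite /graph_weight (bigD1 b) //= {1}/edge_weight (negbTE b12) gb mul0r.
have := E_graph (fun i j => g (i, j)) (B := setT).
rewrite !setTI => Eg.
rewrite (_ : [set w | edge_graph n w = g] =
    [set w | forall i j : 'I_n, (i < j)%N -> E i j w = g (i, j)]); last first.
  apply/seteqP; split => w /= H.
    by move=> i j ij; rewrite -H ffunE /= ij.
  apply/ffunP => -[i j]; rewrite ffunE /=; have := low (i, j); rewrite /=.
  by case: ltnP => /= [ij _|_ /negbTE ->//]; exact: H.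
rewrite Eg; last first.
  by rewrite -(setD0 setT); apply: sigma_algebraCD; exact: sigma_algebra0.
apply: eq_integral => w _; congr (_%:E).
rewrite /graph_prob /graph_weight pair_big_dep /=.
rewrite [LHS]big_mkcond; apply: eq_bigr => -[i j] _.
rewrite /edge_weight /=; have := low (i, j); rewrite /=.
by case: ltnP => //= _ /negbTE ->.
Qed.

Lemma graph_on_edge_graph w :
  graph_on (fun i j => E i j w) = graph_of (edge_graph (N w) w).
Proof.
apply/funext => i; apply/funext => j; rewrite /graph_on /graph_of !ffunE /=.
by case: ltngtP.
Qed.

Let W k w := num_components (@graph_on (N w) (fun i j => E i j w)) k.

Lemma measurable_component_fun k (f : nat -> R) :
  measurable_fun [set: Omega] (fun w => f (W k w)).
Proof.
move=> _ Y mY; rewrite setTI.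
rewrite (_ : _ @^-1` _ = \bigcup_(j in [set j | Y (f j)])
    (component_RV N E k @^-1` [set j%:R])).
  apply: bigcup_measurable => j _; rewrite -[X in measurable X]setTI.
  by apply: measurable_funPT.
apply/seteqP; split => w /=; first by move=> Yw; exists (W k w).
by case=> j /= Yj /eqP; rewrite eqr_nat /W => /eqP ->.
Qed.

(** Given the size and the graph, the count is deterministic, so the expectation is a sum over [n]
    and over the graphs on [n] vertices. All terms are nonnegative, so the identity holds in the
    extended reals before the moment is known to be finite. *)
Lemma expectation_factorial k m :
  (\int[P]_w ((W k w ^_ m * k`! ^ m)%:R)%:E =
   \sum_(n <oo) P (N @^-1` [set n]) *
     (graph_moment law_of_points phi m k n)%:E)%E.
Proof.
have mN n : measurable (N @^-1` [set n]) by exact: measurable_funPTI.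
have NT : \bigcup_n (N @^-1` [set n]) = [set: Omega].
  by apply/seteqP; split => // w _; exists (N w).
rewrite -{1}NT ge0_integral_bigcup //; last first.
- move=> i j _ _ [w [/= <- <-]] //.
- rewrite NT; apply/measurable_EFinP.
  exact: (measurable_component_fun k (fun a => (a ^_ m * k`! ^ m)%:R)).
apply: eq_eseriesr => n _.
pose c (g : {ffun 'I_n * 'I_n -> bool}) : R :=
  (num_components (graph_of g) k ^_ m * k`! ^ m)%:R.
have c0 g : 0 <= c g by [].
pose A g := N @^-1` [set n] `&` [set w | edge_graph n w = g].
have mA g : measurable (A g).
  apply: measurableI => //.
  rewrite (_ : [set w | _] = \bigcap_(b in [set: 'I_n * 'I_n])
     [set w | ((b.1 < b.2)%N && E b.1 b.2 w) = g b]); last first.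
    apply/seteqP; split => w /=; first by move=> <- b _; rewrite ffunE.
    by move=> H; apply/ffunP => b; rewrite ffunE; exact: H.
  apply: fin_bigcap_measurable => [|b _]; first exact: finite_finset.
  have mE : measurable (E b.1 b.2 @^-1` [set g b]) by exact: measurable_funPTI.
  case: (b.1 < b.2)%N => /=; first exact: mE.
  have -> : [set _ : Omega | false = g b] = if g b then set0 else setT.
    by case: (g b); apply/seteqP; split.
  by case: (g b).
transitivity (\sum_g (c g)%:E * P (A g))%E.
  transitivity (\int[P]_(w in N @^-1` [set n])
     \sum_(g : {ffun 'I_n * 'I_n -> bool}) ((c g)%:E * (\1_(A g) w)%:E))%E.
    apply: eq_integral => w; rewrite inE /= => Nw.
    rewrite (bigD1 (edge_graph n w)) //= big1 ?adde0.
      rewrite indicE mem_set // mule1 /c /W graph_on_edge_graph.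
      by rewrite -Nw.
    move=> g gw; rewrite indicE memNset ?mule0 // => -[_ /= E'].
    by rewrite E' eqxx in gw.
  rewrite ge0_integral_sum //.
  - apply: eq_bigr => g _; rewrite ge0_integralZl ?lee_fin //.
      by rewrite integral_indic // /A setIAC setIid.
    by apply/measurable_EFinP/measurable_indic.
  - move=> g; apply: measurable_funeM; apply/measurable_EFinP.
    by apply: measurable_funTS; exact: measurable_indic.
  - by move=> g w _; rewrite -EFinM lee_fin mulr_ge0.
have [_ _ phi01] := phi_conn.
have gw01 (g : {ffun 'I_n * 'I_n -> bool}) (x : S) :
    0 <= graph_weight phi (fun i : 'I_n => x i) g <= 1.
  rewrite graph_weight_ge0 //= -(sum_graph_weight phi (fun i : 'I_n => x i)).
  by rewrite (bigD1 g) //= lerDl sumr_ge0 // => h _; exact: graph_weight_ge0.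
have mgw (g : {ffun 'I_n * 'I_n -> bool}) : measurable_fun [set: S]
   (fun x : S => graph_weight phi (fun i : 'I_n => x i) g).
  exact: (measurable_graph_weight phi_conn (@nat_of_ord n) g).
have mh : measurable_fun [set: S] (fun x : S =>
    \sum_(g : {ffun 'I_n * 'I_n -> bool})
    graph_weight phi (fun i : 'I_n => x i) g * c g).
  apply: measurable_sum => g; apply: measurable_funM => //; exact: measurable_cst.
have hc (x : S) : 0 <= \sum_(g : {ffun 'I_n * 'I_n -> bool})
    graph_weight phi (fun i : 'I_n => x i) g * c g <= \sum_g c g.
  apply/andP; split.
    by apply: sumr_ge0 => g _; rewrite mulr_ge0 //; case/andP: (gw01 g x).
  by apply: ler_sum => g _; rewrite ler_piMl //; case/andP: (gw01 g x).
apply: (etrans _ (integral_points_given_size n mh hc)).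
transitivity (\int[P]_(w in N @^-1` [set n]) (\sum_(g : {ffun 'I_n * 'I_n -> bool})
   (c g)%:E * (graph_weight phi (fun i : 'I_n => points w i) g)%:E))%E; last first.
  by apply: eq_integral => w _; rewrite -sumEFin; apply: eq_bigr => g _;
    rewrite -EFinM mulrC.
rewrite ge0_integral_sum //.
- apply: eq_bigr => g _; rewrite edge_graph_prob ge0_integralZl ?lee_fin //.
  + apply: measurable_funTS; apply/measurable_EFinP.
    exact: (measurableT_comp (mgw g) measurable_points).
  + by move=> w _; rewrite lee_fin; case/andP: (gw01 g (points w)).
- move=> g; apply: measurable_funeM; apply: measurable_funTS; apply/measurable_EFinP.
  exact: (measurableT_comp (mgw g) measurable_points).
- move=> g w _; rewrite -EFinM lee_fin mulr_ge0 //.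
  by case/andP: (gw01 g (points w)).
Qed.

End law_of_points.

(** * Poisson and binomial averages *)

(** Write p for the product and s for the sum. The induction carries p (1 + s) <= 1, which yields
    the upper bound because (1 + s) (1 - s + s ^ 2) = 1 + s ^ 3 >= 1. *)
Lemma prod_1sub_bounds (R : realFieldType) (I : finType) (a : I -> R) :
  (forall i, 0 <= a i <= 1) ->
  1 - \sum_i a i <= \prod_i (1 - a i) <= 1 - (1 - \sum_i a i) * \sum_i a i.
Proof.
move=> a01.
suff : forall r : seq I, [/\ 0 <= \sum_(i <- r) a i, 0 <= \prod_(i <- r) (1 - a i),
    1 - \sum_(i <- r) a i <= \prod_(i <- r) (1 - a i) &
    \prod_(i <- r) (1 - a i) * (1 + \sum_(i <- r) a i) <= 1].
  move=> /(_ (index_enum I)) [s0 p0 -> le1] /=.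
  move: s0 p0 le1; set s := \sum_i _; set p := \prod_i _ => s0 p0 le1.
  have [s1|s1] := leP s 1; first by nra.
  have : p <= 1 by nra.
  nra.
elim => [|i r [s0 p0 l1 l2]]; first by rewrite !big_nil; split; lra.
rewrite !big_cons; have /andP[ai0 ai1] := a01 i.
move: s0 p0 l1 l2; set s := \sum_(_ <- _) _; set p := \prod_(_ <- _) _ => s0 p0 l1 l2.
split; [lra|by rewrite mulr_ge0 ?subr_ge0| |].
- have p1 : p <= 1 by nra.
  nra.
- have : p * s <= 1 - p by lra.
  have : 0 <= p * s by exact: mulr_ge0.
  set ps := p * s => ps0 ps1.
  have -> : (1 - a i) * p * (1 + (a i + s)) =
    (p + ps) - a i * a i * p - a i * ps by rewrite /ps; ring.
  have : 0 <= a i * a i * p by rewrite !mulr_ge0.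
  have : 0 <= a i * ps by rewrite mulr_ge0.
  lra.
Qed.

Lemma nneseries_exp_coeff (R : realType) (x : R) :
  (\sum_(n <oo) (exp_coeff x n)%:E = (expR x)%:E)%E.
Proof.
apply/cvg_lim => //.
rewrite (_ : (fun n => _) = EFin \o series (exp_coeff x)); last first.
  by apply/funext => n /=; rewrite sumEFin /series.
apply: cvg_EFin; first exact: nearW.
exact: is_cvg_series_exp_coeff.
Qed.

(** Both sides are the m-th derivative in v of the Poisson generating function exp (- s (1 - v)). *)
Lemma nneseries_poisson_ffact (R : realType) (s v : R) (m : nat) :
  0 < s -> 0 <= v ->
  (\sum_(n <oo) (poisson_pmf s n * ((n ^_ m)%:R * v ^+ (n - m)))%:E =
   (s ^+ m * expR (- s * (1 - v)))%:E)%E.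
Proof.
move=> s0 v0.
have u0 n : (0 <= (poisson_pmf s n * ((n ^_ m)%:R * v ^+ (n - m)))%:E)%E.
  by rewrite lee_fin !mulr_ge0 ?poisson_pmf_ge0 ?exprn_ge0.
(* The terms with [n < m], where the subtraction [n - m] is truncated, vanish with the falling
   factorial. *)
rewrite (nneseries_split 0 m) // big1_seq ?add0e; last first.
  move=> n; rewrite mem_index_iota /= add0n => /ffact_small ->.
  by rewrite mul0r mulr0.
rewrite add0n -nneseries_addn //.
transitivity (\sum_(n <oo) (s ^+ m * expR (- s))%:E * (exp_coeff (s * v) n)%:E)%E.
  apply: eq_eseriesr => n _; rewrite -EFinM; congr (_%:E).
  rewrite addnK /poisson_pmf s0 /exp_coeff /= exprMn exprD.
  have nm0 : (n + m)`!%:R != 0 :> R by rewrite pnatr_eq0 -lt0n fact_gt0.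
  have n0 : n`!%:R != 0 :> R by rewrite pnatr_eq0 -lt0n fact_gt0.
  have -> : ((n + m) ^_ m)%:R = (n + m)`!%:R / n`!%:R :> R.
    have <- : ((n + m) ^_ m * n`!)%N = (n + m)`!.
      by have := ffact_fact (leq_addl n m); rewrite addnK.
    by rewrite natrM mulfK.
  by field; apply/andP.
rewrite nneseriesZl ?nneseries_exp_coeff -?EFinM.
  by congr (_%:E); rewrite -mulrA -expRD; congr (_ * expR _); ring.
by move=> n _; rewrite lee_fin /exp_coeff /= divr_ge0 ?exprn_ge0 // mulr_ge0 // ltW.
Qed.

(** * First order approximation of the avoidance probability *)

Section reference_integrals.
Context d (T : measurableType d) (R : realType) (mu : probability T R).
Local Notation S := (sequences T).
Variables (nu : probability S R) (nu_iid : iid mu nu).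
Variables (phi : T -> T -> R) (phi_conn : connection_function phi).
Variable q : R.
Hypothesis phiq : forall s t, phi s t <= q.

Let phi01 s t : 0 <= phi s t <= 1.
Proof. by case: phi_conn => _ _; exact. Qed.

Let phi0q s t : 0 <= phi s t <= q.
Proof. by case/andP: (phi01 s t) => -> _; exact: phiq. Qed.

Definition mean_degree (t : T) : R := \int[nu]_y phi t (y 0%N).

Definition total_degree m k (x : S) : R :=
  \sum_(p : 'I_m * 'I_k) mean_degree (x (p.1 * k + p.2)%N).

Lemma measurable_mean_degree i :
  measurable_fun [set: S] (fun x : S => mean_degree (x i)).
Proof.
apply: (@measurable_Rintegral_snd _ _ _ nu (fun xy => phi (xy.1 i) (xy.2 0%N)) q).
  apply: (measurable_phi phi_conn).
    exact: (measurableT_comp (measurable_coordinate _) measurable_fst).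
  exact: (measurableT_comp (measurable_coordinate _) measurable_snd).
by move=> z; exact: phi0q.
Qed.

Lemma measurable_phi_coordinate t :
  measurable_fun [set: S] (fun y : S => phi t (y 0%N)).
Proof.
apply: (measurable_phi phi_conn); first exact: measurable_cst.
exact: measurable_coordinate.
Qed.

Lemma mean_degree_bounds t : 0 <= mean_degree t <= q.
Proof.
by apply: Rintegral_bounds => [|y]; [exact: measurable_phi_coordinate|exact: phi0q].
Qed.

Lemma measurable_total_degree m k : measurable_fun [set: S] (total_degree m k).
Proof. by apply: measurable_sum => p; exact: measurable_mean_degree. Qed.

Lemma total_degree_bounds m k (x : S) :
  0 <= total_degree m k x <= (m * k)%:R * q.
Proof.
apply/andP; split.
  by apply: sumr_ge0 => p _; case/andP: (mean_degree_bounds (x (p.1 * k + p.2)%N)).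
have -> : (m * k)%:R * q = \sum_(p : 'I_m * 'I_k) q.
  by rewrite sumr_const card_prod !card_ord mulr_natl.
by apply: ler_sum => p _; case/andP: (mean_degree_bounds (x (p.1 * k + p.2)%N)).
Qed.

Lemma total_degreeE m k (x : S) :
  total_degree m k x =
  \int[nu]_y (\sum_(p : 'I_m * 'I_k) phi (x (p.1 * k + p.2)%N) (y 0%N)).
Proof.
rewrite Rintegral_sum // => p.
by apply: (@integrable_bounded _ _ _ _ _ q) => [|y];
  [exact: measurable_phi_coordinate|exact: phi0q].
Qed.

(** The bounds of [prod_1sub_bounds] are integrated over the new point. Pointwise the sum of the
    connection probabilities is at most [(m * k) * q], so the quadratic correction is at most that
    multiple of the linear term. *)
Lemma mean_avoid_bounds m k (x : S) :
  1 - total_degree m k x <= mean_avoid nu phi m k x <=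
  1 - (1 - (m * k)%:R * q) * total_degree m k x.
Proof.
pose s (y : S) := \sum_(p : 'I_m * 'I_k) phi (x (p.1 * k + p.2)%N) (y 0%N).
have ms : measurable_fun [set: S] s.
  by apply: measurable_sum => p; exact: measurable_phi_coordinate.
have s0 y : 0 <= s y <= (m * k)%:R * q.
  apply/andP; split.
    by apply: sumr_ge0 => p _; case/andP: (phi0q (x (p.1 * k + p.2)%N) (y 0%N)).
  have -> : (m * k)%:R * q = \sum_(p : 'I_m * 'I_k) q.
    by rewrite sumr_const card_prod !card_ord mulr_natl.
  by apply: ler_sum => p _; exact: phiq.
have ints : nu.-integrable setT (EFin \o s) by exact: integrable_bounded ms s0.
have int1 : nu.-integrable setT (EFin \o (fun _ : S => 1 : R)).
  apply: (@integrable_bounded _ _ _ _ _ 1); first exact: measurable_cst.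
  by move=> _; rewrite ler01 lexx.
have inta : nu.-integrable setT (EFin \o (fun y : S => avoid phi m k x (y 0%N))).
  apply: (@integrable_bounded _ _ _ _ _ 1) => [|y]; last exact: avoid01.
  exact: (measurable_section x (measurable_avoid phi_conn m k)).
have intZ c : nu.-integrable setT (EFin \o (fun y => c * s y)).
  by apply: eq_integrable (integrableZl _ c ints).
have H y := prod_1sub_bounds (fun p : 'I_m * 'I_k => phi01 (x (p.1 * k + p.2)%N) (y 0%N)).
rewrite total_degreeE -RintegralZl //.
have sub1 c : 1 - \int[nu]_y (c * s y) = \int[nu]_y (1 - c * s y).
  by rewrite RintegralB // Rintegral_probability_cst.
have -> : 1 - \int[nu]_y s y = \int[nu]_y (1 - s y).
  by rewrite RintegralB // Rintegral_probability_cst.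
rewrite sub1.
apply/andP; split; apply: le_Rintegral => //.
- exact: eq_integrable (integrableB _ int1 ints).
- by move=> y _; case/andP: (H y).
- exact: eq_integrable (integrableB _ int1 (intZ _)).
- move=> y _; case/andP: (H y) => _ /le_trans; apply.
  case/andP: (s0 y) => sy0 sy1; rewrite -/(s y) lerD2l lerN2 ler_wpM2r //.
  by rewrite lerD2l lerN2.
Qed.

(* Replacing [1 - mean_avoid] by its first order term [total_degree] makes the
   integrand multiplicative over the groups. *)
Definition reference_integral k (s : R) : R :=
  \int[nu]_x (conn_prob phi (fun l : 'I_k => x l) *
    expR (- s * \sum_(l < k) mean_degree (x l))).

Definition poisson_integral m k (s : R) : R :=
  \int[nu]_x (conn_blocks phi m k x * expR (- s * (1 - mean_avoid nu phi m k x))).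

Lemma reference_integralX m k (s : R) : 0 <= s ->
  reference_integral k s ^+ m =
  \int[nu]_x (conn_blocks phi m k x * expR (- s * total_degree m k x)).
Proof.
move=> s0; rewrite /reference_integral.
have sum0 (x : S) : 0 <= \sum_(l < k) mean_degree (x l).
  by apply: sumr_ge0 => l _; case/andP: (mean_degree_bounds (x l)).
rewrite -(@Rintegral_prod_blocks _ _ _ mu nu nu_iid k m _ 1).
- apply: eq_Rintegral => x _; rewrite big_split /= -expR_sum.
  congr (_ * expR _); rewrite -mulr_sumr; congr (_ * _).
  by rewrite pair_big.
- apply: measurable_funM; first exact: (measurable_conn_prob phi_conn).
  apply: measurableT_comp => //; apply: measurable_funM; first exact: measurable_cst.
  by apply: measurable_sum => l; exact: measurable_mean_degree.
- move=> x; apply/andP; split.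
    by rewrite mulr_ge0 ?expR_ge0 // conn_prob_ge0.
  rewrite mulr_ile1 ?expR_ge0 ?conn_prob_ge0 ?conn_prob_le1 //.
  by rewrite -[leRHS]expR0 ler_expR mulNr oppr_le0 mulr_ge0.
- move=> x y xy; congr (conn_prob _ _ * expR (_ * _)).
    by apply/funext => l; exact: xy.
  by apply: eq_bigr => l _; rewrite xy.
Qed.

Let c01 m k (x : S) := conn_blocks01 phi_conn m k x.

Let mc m k := measurable_conn_blocks phi_conn m k.

Let mV m k := measurable_mean_avoid nu phi_conn m k.

Let measurable_exp (g : S -> R) (s : R) : measurable_fun [set: S] g ->
  measurable_fun [set: S] (fun x => expR (s * g x)).
Proof.
move=> mg; apply: measurableT_comp => //.
by apply: measurable_funM => //; exact: measurable_cst.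
Qed.

Let integrable_conn_exp m k (g : S -> R) (s : R) : 0 <= s ->
  measurable_fun [set: S] g -> (forall x, 0 <= g x) ->
  nu.-integrable setT (EFin \o (fun x => conn_blocks phi m k x * expR (- s * g x))).
Proof.
move=> s0 mg g0; apply: (@integrable_bounded _ _ _ _ _ 1).
  by apply: measurable_funM; [exact: mc|exact: measurable_exp].
move=> x; have /andP[c0 c1] := c01 m k x.
rewrite mulr_ge0 ?expR_ge0 //= mulr_ile1 ?expR_ge0 //.
by rewrite expR_le1 mulNr oppr_le0 mulr_ge0.
Qed.

Let measurable_hit m k : measurable_fun [set: S] (fun x : S => 1 - mean_avoid nu phi m k x).
Proof. by apply: measurable_funB; [exact: measurable_cst|exact: mV]. Qed.

Let hit_ge0 m k (x : S) : 0 <= 1 - mean_avoid nu phi m k x.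
Proof. by rewrite subr_ge0; case/andP: (mean_avoid01 nu phi_conn m k x). Qed.

Lemma poisson_integral_ge m k (s : R) : 0 <= s ->
  reference_integral k s ^+ m <= poisson_integral m k s.
Proof.
move=> s0; rewrite reference_integralX //; apply: le_Rintegral => //.
- apply: integrable_conn_exp => //; first exact: measurable_total_degree.
  by move=> x; case/andP: (total_degree_bounds m k x).
- exact: integrable_conn_exp.
- move=> x _; have /andP[c0 _] := c01 m k x.
  rewrite ler_wpM2l // ler_expR !mulNr lerN2 ler_wpM2l //.
  by case/andP: (mean_avoid_bounds m k x); lra.
Qed.

(* The cutoff [L] separates the [x] with [s * total_degree m k x <= L], where the
   second order terms are negligible, from the others, whose total contribution
   is at most [expR (- (L / 2))]. *)
Lemma poisson_integral_le m k (s L : R) : 0 <= s -> 0 <= L -> 0 <= q ->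
  (m * k)%:R * q <= 1 / 2 ->
  poisson_integral m k s <=
    expR ((m * k)%:R * q * L) * reference_integral k s ^+ m + expR (- (L / 2)).
Proof.
move=> s0 L0 q0 mkq; rewrite reference_integralX // -RintegralZl //; last first.
  apply: integrable_conn_exp => //; first exact: measurable_total_degree.
  by move=> x; case/andP: (total_degree_bounds m k x).
rewrite -[expR (- _)](Rintegral_probability_cst nu).
have int1 : nu.-integrable setT (EFin \o (fun x => expR ((m * k)%:R * q * L) *
    (conn_blocks phi m k x * expR (- s * total_degree m k x)))).
  apply: eq_integrable (integrableZl _ (expR ((m * k)%:R * q * L))
    (@integrable_conn_exp m k (total_degree m k) s s0 _ _)) => //.
    exact: measurable_total_degree.
  by move=> x; case/andP: (total_degree_bounds m k x).
have int2 : nu.-integrable setT (EFin \o (fun _ : S => expR (- (L / 2)))).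
  apply: (@integrable_bounded _ _ _ _ _ (expR (- (L / 2)))).
    exact: measurable_cst.
  by move=> _; rewrite expR_ge0 lexx.
rewrite -RintegralD //; apply: le_Rintegral => //.
- exact: integrable_conn_exp.
- exact: eq_integrable (integrableD _ int1 int2).
move=> x _; have /andP[c0 c1] := c01 m k x.
have /andP[_ Vle] := mean_avoid_bounds m k x.
have /andP[D0 _] := total_degree_bounds m k x.
set D := total_degree m k x in Vle D0 *; set V := mean_avoid _ _ _ _ _ in Vle *.
set Q := (m * k)%:R * q in Vle mkq *.
have Q0 : 0 <= Q by rewrite mulr_ge0.
have [sDL|sDL] := leP (s * D) L.
  apply: (@le_trans _ _ (expR (Q * L) * (conn_blocks phi m k x * expR (- s * D)))).
    rewrite mulrCA ler_wpM2l // -expRD ler_expR.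
    have : s * (1 - V) >= s * ((1 - Q) * D) by rewrite ler_wpM2l //; lra.
    have : Q * (s * D) <= Q * L by rewrite ler_wpM2l.
    lra.
  by rewrite lerDl expR_ge0.
(* Beyond the cutoff, [Q <= 1 / 2] leaves [s * (1 - V) >= s * D / 2 > L / 2], so the integrand
   itself is small. *)
apply: (@le_trans _ _ (expR (- (L / 2)))).
  apply: (@le_trans _ _ (1 * expR (- s * (1 - V)))).
    by rewrite ler_wpM2r // expR_ge0.
  rewrite mul1r ler_expR.
  have : s * (1 - V) >= s * ((1 - Q) * D) by rewrite ler_wpM2l //; lra.
  have : (1 / 2) * (s * D) <= (1 - Q) * (s * D).
    by rewrite ler_wpM2r ?mulr_ge0 //; lra.
  lra.
by rewrite lerDr !mulr_ge0 ?expR_ge0.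
Qed.

(** From [V <= exp (- (1 - V))], the power [n - m * k] of [V] exceeds [exp (- n (1 - V))] by at most
    the factor [exp (m k (1 - V))], and [1 - V <= D <= m k q]. *)
Lemma blocks_integral_le m k n : 0 <= q -> (m * k <= n)%N ->
  blocks_integral nu phi m k n <=
  expR ((m * k)%:R * ((m * k)%:R * q)) * poisson_integral m k n%:R.
Proof.
move=> q0 mkn; rewrite -RintegralZl //; last exact: integrable_conn_exp.
have V01 := mean_avoid01 nu phi_conn m k.
apply: le_Rintegral => //.
- apply: (@integrable_bounded _ _ _ _ _ 1).
    by apply: measurable_funM; [exact: mc|apply: measurable_funX; exact: mV].
  move=> x; have /andP[c0 c1] := c01 m k x; have /andP[V0 V1] := V01 x.
  by rewrite mulr_ge0 ?exprn_ge0 //= mulr_ile1 ?exprn_ge0 // exprn_ile1.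
- exact: eq_integrable (integrableZl _ _ (@integrable_conn_exp m k _ n%:R _
    (measurable_hit m k) (hit_ge0 m k))).
move=> x _; have /andP[c0 c1] := c01 m k x; have /andP[V0 V1] := V01 x.
have /andP[Vge _] := mean_avoid_bounds m k x.
have /andP[D0 Dle] := total_degree_bounds m k x.
set V := mean_avoid _ _ _ _ _ in V0 V1 Vge *.
rewrite mulrCA ler_wpM2l //.
have VE : V <= expR (- (1 - V)) by have := expR_ge1Dx (- (1 - V)); lra.
apply: (@le_trans _ _ (expR (- (1 - V)) ^+ (n - m * k))).
  by apply: lerXn2r => //; rewrite nnegrE ?expR_ge0.
rewrite -expRM_natl natrB // -expRD ler_expR.
have : (m * k)%:R * (1 - V) <= (m * k)%:R * ((m * k)%:R * q).
  by rewrite ler_wpM2l //; lra.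
lra.
Qed.

(** With [v = 1 - V <= 1 / 2] one has [log V >= - v - 2 v ^ 2]. The second term occurs [n] times and
    [v <= m k q], so the loss is governed by [n q ^ 2]. *)
Lemma blocks_integral_ge m k n : 0 <= q -> (m * k)%:R * q <= 1 / 2 ->
  expR (- (2 * (n%:R * ((m * k)%:R * q) ^+ 2))) * poisson_integral m k n%:R <=
  blocks_integral nu phi m k n.
Proof.
move=> q0 mkq; rewrite -RintegralZl //; last exact: integrable_conn_exp.
have V01 := mean_avoid01 nu phi_conn m k.
apply: le_Rintegral => //.
- exact: eq_integrable (integrableZl _ _ (@integrable_conn_exp m k _ n%:R _
    (measurable_hit m k) (hit_ge0 m k))).
- apply: (@integrable_bounded _ _ _ _ _ 1).
    by apply: measurable_funM; [exact: mc|apply: measurable_funX; exact: mV].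
  move=> x; have /andP[c0 c1] := c01 m k x; have /andP[V0 V1] := V01 x.
  by rewrite mulr_ge0 ?exprn_ge0 //= mulr_ile1 ?exprn_ge0 // exprn_ile1.
move=> x _; have /andP[c0 c1] := c01 m k x; have /andP[V0 V1] := V01 x.
have /andP[Vge _] := mean_avoid_bounds m k x.
have /andP[D0 Dle] := total_degree_bounds m k x.
set V := mean_avoid _ _ _ _ _ in V0 V1 Vge *.
set Q := (m * k)%:R * q in mkq Dle *.
rewrite mulrCA ler_wpM2l //.
pose v := 1 - V; have v0 : 0 <= v by rewrite subr_ge0.
have vQ : v <= Q by rewrite /v; lra.
(* The constant 2 comes from (1 - v) (1 + v + 2 v ^ 2) = 1 + v ^ 2 (1 - 2 v), which is at least 1
   for v <= 1 / 2. *)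
have VE : expR (- (v + 2 * v ^+ 2)) <= V.
  have e1 := expR_ge1Dx (v + 2 * v ^+ 2).
  rewrite expRN -[V]invrK lef_pV2 ?posrE ?expR_gt0 ?invr_gt0 //; last by rewrite /v in vQ; lra.
  apply: le_trans e1; rewrite -div1r ler_pdivrMr; last by lra.
  have -> : V = 1 - v by rewrite /v; ring.
  have : v ^+ 2 * (1 - 2 * v) >= 0 by rewrite mulr_ge0 ?sqr_ge0 //; lra.
  lra.
apply: (@le_trans _ _ (V ^+ n)); last first.
  by apply: ler_wiXn2l => //; exact: leq_subr.
apply: (@le_trans _ _ (expR (- (v + 2 * v ^+ 2)) ^+ n)); last first.
  by apply: lerXn2r => //; rewrite nnegrE ?expR_ge0.
rewrite -expRM_natl -expRD ler_expR -/v.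
have : n%:R * v ^+ 2 <= n%:R * Q ^+ 2.
  by rewrite ler_wpM2l // lerXn2r // nnegrE // (le_trans v0).
lra.
Qed.

(** By Tonelli the sum over [n] is taken first, for a fixed position of the groups; it is then a
    derivative of the Poisson generating function at [mean_avoid]. *)
Lemma nneseries_poisson_blocks m k (s : R) : 0 < s ->
  (\sum_(n <oo) (poisson_pmf s n)%:E *
     ((n ^_ (m * k))%:R * blocks_integral nu phi m k n)%:E =
   (s ^+ (m * k) * poisson_integral m k s)%:E)%E.
Proof.
move=> s0; have V01 := mean_avoid01 nu phi_conn m k.
pose f n (x : S) := poisson_pmf s n * ((n ^_ (m * k))%:R *
   mean_avoid nu phi m k x ^+ (n - m * k)) * conn_blocks phi m k x.
have f0 n x : 0 <= f n x.
  have /andP[c0 _] := c01 m k x; have /andP[V0 _] := V01 x.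
  by rewrite !mulr_ge0 ?poisson_pmf_ge0 ?exprn_ge0.
have mf n : measurable_fun [set: S] (f n).
  apply: measurable_funM; last exact: mc.
  do 2!(apply: measurable_funM; first exact: measurable_cst).
  by apply: measurable_funX; exact: mV.
have mfE n : measurable_fun [set: S] (EFin \o f n) by exact/measurable_EFinP.
transitivity (\sum_(n <oo) \int[nu]_x (f n x)%:E)%E.
  apply: eq_eseriesr => n _; rewrite -EFinM mulrA -RintegralZl //; last first.
    apply: (@integrable_bounded _ _ _ _ _ 1).
      by apply: measurable_funM; [exact: mc|apply: measurable_funX; exact: mV].
    move=> x; have /andP[c0 c1] := c01 m k x; have /andP[V0 V1] := V01 x.
    by rewrite mulr_ge0 ?exprn_ge0 //= mulr_ile1 ?exprn_ge0 // exprn_ile1.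
  rewrite -(@EFin_Rintegral_bounded _ _ _ nu _ (poisson_pmf s n * (n ^_ (m * k))%:R)) //.
    by congr (_%:E); apply: eq_Rintegral => x _; rewrite /f; ring.
  move=> x; rewrite f0 /=; have /andP[c0 c1] := c01 m k x; have /andP[V0 V1] := V01 x.
  rewrite /f mulrA -mulrA ler_piMr ?mulr_ge0 ?poisson_pmf_ge0 //.
  by rewrite mulr_ile1 ?exprn_ge0 // exprn_ile1.
rewrite -(@integral_nneseries _ _ _ nu _ measurableT (fun n => EFin \o f n)) //; last first.
  by move=> n x _; rewrite lee_fin.
transitivity (\int[nu]_x ((s ^+ (m * k) * (conn_blocks phi m k x *
   expR (- s * (1 - mean_avoid nu phi m k x))))%:E))%E.
  apply: eq_integral => x _; have /andP[c0 c1] := c01 m k x; have /andP[V0 V1] := V01 x.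
  rewrite mulrCA EFinM -nneseries_poisson_ffact // -nneseriesZl /=.
    by apply: eq_eseriesr => n _; rewrite /f EFinM muleC.
  by move=> n _; rewrite lee_fin !mulr_ge0 ?poisson_pmf_ge0 ?exprn_ge0.
rewrite -RintegralZl //; last by apply: integrable_conn_exp => //; exact: ltW.
rewrite (@EFin_Rintegral_bounded _ _ _ nu _ (s ^+ (m * k))) //.
  apply: measurable_funM; first exact: measurable_cst.
  by apply: measurable_funM; [exact: mc|exact: measurable_exp].
move=> x; have /andP[c0 c1] := c01 m k x.
rewrite !mulr_ge0 ?expR_ge0 ?exprn_ge0 ?(ltW s0) //= ler_piMr ?exprn_ge0 ?(ltW s0) //.
by rewrite mulr_ile1 ?expR_ge0 // expR_le1 mulNr oppr_le0 mulr_ge0 // ltW.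
Qed.

End reference_integrals.

(** * Bounds on factorial moments *)

Lemma poisson_law_set1 (R : realType) (alpha : R) j : 0 < alpha ->
  poisson_law alpha [set j] = (poisson_pmf alpha j)%:E.
Proof.
move=> alpha0; transitivity (poisson_prob alpha 0%N [set j]) => //.
by rewrite /poisson_prob alpha0 esum_set1 // lee_fin poisson_pmf_ge0.
Qed.

Section factorial_moments.
Context d (T : measurableType d) (R : realType) (mu : probability T R).
Context d' (Omega : measurableType d') (P : probability Omega R).
Variable X : nat -> {RV P >-> T}.
Hypothesis X_law : forall i, has_law (X i) mu.
Hypothesis X_indep : mutually_independent X.
Local Notation nu := (law_of_points X).
Variables (phi : T -> T -> R) (phi_conn : connection_function phi).
Variable q : R.
Hypothesis phiq : forall s t, phi s t <= q.
Hypothesis q01 : 0 <= q <= 1.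
Variables (k : nat) (k_gt0 : (0 < k)%N) (m : nat).

Let phi01 s t : 0 <= phi s t <= 1.
Proof. by case: phi_conn => _ _; exact. Qed.

Definition component_number (N : {RV P >-> nat}) (E : nat -> nat -> {RV P >-> bool})
    (w : Omega) : nat :=
  num_components (@graph_on (N w) (fun i j => E i j w)) k.

Lemma blocks_integral_ge0 n : 0 <= blocks_integral nu phi m k n.
Proof.
apply: Rintegral_ge0 => x _; have /andP[c0 _] := conn_blocks01 phi_conn m k x.
by rewrite mulr_ge0 // exprn_ge0 //; case/andP: (mean_avoid01 nu phi_conn m k x).
Qed.

Lemma expectation_factorialZ N (E : nat -> nat -> {RV P >-> bool}) :
  (\int[P]_w ((component_number N E w ^_ m * k`! ^ m)%:R)%:E =
   ((k`! ^ m)%:R)%:E * \int[P]_w ((component_number N E w ^_ m)%:R)%:E)%E.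
Proof.
rewrite -ge0_integralZl ?lee_fin //.
  by apply: eq_integral => w _; rewrite -EFinM mulrC natrM.
apply/measurable_EFinP.
exact: (measurable_component_fun N E k (fun a => (a ^_ m)%:R)).
Qed.

Lemma poisson_factorial_moment (N : {RV P >-> nat}) (E : nat -> nat -> {RV P >-> bool})
    (s : R) : 0 < s -> has_law N (poisson_law s) -> independent_of_points N X ->
  random_connection_graph phi X N E ->
  exists2 f : R,
    (\int[P]_w ((component_number N E w ^_ m)%:R)%:E = f%:E)%E &
    (1 - q) ^+ (m * k * (m * k)) * (s ^+ (m * k) * poisson_integral nu phi m k s) <=
    (k`! ^ m)%:R * f <= s ^+ (m * k) * poisson_integral nu phi m k s.
Proof.
move=> s0 Nlaw Nind Egraph.
have nu_iid := law_of_points_iid X_law X_indep.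
pose c := (1 - q) ^+ (m * k * (m * k)).
have c0 : 0 <= c by rewrite exprn_ge0 // subr_ge0; case/andP: q01.
set Q := s ^+ (m * k) * _.
have PN n : P (N @^-1` [set n]) = (poisson_pmf s n)%:E.
  have := Nlaw [set n] I; rewrite /distribution /pushforward => ->.
  exact: poisson_law_set1.
have bnd n := graph_moment_bounds nu_iid phi_conn m n k_gt0 phiq q01.
have gE := expectation_factorial Nind phi_conn Egraph k m.
have sumQ := nneseries_poisson_blocks nu phi_conn m k s0.
have ub0 n : 0 <= (n ^_ (m * k))%:R * blocks_integral nu phi m k n.
  by rewrite mulr_ge0 // blocks_integral_ge0.
have upper : (((k`! ^ m)%:R)%:E *
    \int[P]_w ((component_number N E w ^_ m)%:R)%:E <= Q%:E)%E.
  rewrite -expectation_factorialZ gE /Q -sumQ; apply: lee_nneseries => n _.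
    move=> _; rewrite PN -EFinM lee_fin mulr_ge0 ?poisson_pmf_ge0 //.
    by case/andP: (bnd n) => gl _; apply: (le_trans _ gl); exact: mulr_ge0.
  by rewrite PN -!EFinM lee_fin ler_wpM2l ?poisson_pmf_ge0 //; case/andP: (bnd n).
have lower : ((c * Q)%:E <=
    ((k`! ^ m)%:R)%:E * \int[P]_w ((component_number N E w ^_ m)%:R)%:E)%E.
  rewrite -expectation_factorialZ gE EFinM /Q -sumQ -nneseriesZl; last first.
    by move=> n _; rewrite -EFinM lee_fin mulr_ge0 ?poisson_pmf_ge0.
  apply: lee_nneseries => n _.
    by move=> _; rewrite -!EFinM lee_fin !mulr_ge0 ?poisson_pmf_ge0 ?blocks_integral_ge0.
  rewrite PN -!EFinM lee_fin mulrCA ler_wpM2l ?poisson_pmf_ge0 //.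
  by case/andP: (bnd n).
have K0 : (0 : R) < (k`! ^ m)%:R by rewrite ltr0n expn_gt0 fact_gt0.
have I0 : (0 <= \int[P]_w ((component_number N E w ^_ m)%:R)%:E)%E.
  by apply: integral_ge0 => w _; rewrite lee_fin.
(* So far the moment is an extended real; the upper bound, with a positive factor in front of the
   moment, excludes the infinite value. *)
have : (\int[P]_w ((component_number N E w ^_ m)%:R)%:E \is a fin_num)%E.
  rewrite ge0_fin_numE //; case: (integral _ _ _) I0 upper => [r _ _|_|//].
    exact: ltry.
  by rewrite gt0_muley ?lte_fin // leye_eq.
move=> /fineK fE; exists (fine (\int[P]_w ((component_number N E w ^_ m)%:R)%:E)%E) => //.
by apply/andP; split; rewrite -lee_fin; [rewrite [leRHS]EFinM fE|rewrite [leLHS]EFinM fE].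
Qed.

Lemma independent_of_points_cst n : independent_of_points (cst n : {RV P >-> nat}) X.
Proof.
move=> A B _; rewrite preimage_cst; case: ifPn => _.
  by rewrite setTI probability_setT mul1e.
by rewrite set0I measure0 mul0e.
Qed.

Lemma binomial_factorial_moment n (E : nat -> nat -> {RV P >-> bool}) :
  random_connection_graph phi X (cst n) E ->
  exists2 f : R,
    (\int[P]_w ((component_number (cst n) E w ^_ m)%:R)%:E = f%:E)%E &
    (1 - q) ^+ (m * k * (m * k)) *
      ((n ^_ (m * k))%:R * blocks_integral nu phi m k n) <=
    (k`! ^ m)%:R * f <= (n ^_ (m * k))%:R * blocks_integral nu phi m k n.
Proof.
move=> Egraph.
have nu_iid := law_of_points_iid X_law X_indep.
have bnd := graph_moment_bounds nu_iid phi_conn m n k_gt0 phiq q01.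
have gE := expectation_factorial (@independent_of_points_cst n) phi_conn Egraph k m.
have K0 : (k`! ^ m)%:R != 0 :> R by rewrite pnatr_eq0 -lt0n expn_gt0 fact_gt0.
exists (graph_moment nu phi m k n / (k`! ^ m)%:R); last first.
  by rewrite [(k`! ^ m)%:R * _]mulrC divfK.
have : (((k`! ^ m)%:R)%:E * \int[P]_w ((component_number (cst n) E w ^_ m)%:R)%:E =
    (graph_moment nu phi m k n)%:E)%E.
  rewrite -expectation_factorialZ gE.
  (* For a constant size the series over sizes has the single nonzero term of index [n]. *)
  rewrite (nneseries_split 0 n.+1); last first.
    move=> j _; rewrite mule_ge0 // lee_fin.
    case/andP: (graph_moment_bounds nu_iid phi_conn m j k_gt0 phiq q01) => gl _.
    apply: (le_trans _ gl); rewrite mulr_ge0 // ?mulr_ge0 ?blocks_integral_ge0 //.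
    by rewrite exprn_ge0 // subr_ge0; case/andP: q01.
  rewrite add0n big_nat_recr //= big1_seq ?add0e; last first.
    move=> j; rewrite mem_index_iota /= => jn.
    rewrite preimage_cst ifN ?measure0 ?mul0e //.
    by apply/negP; rewrite inE /= => nj; rewrite nj ltnn in jn.
  rewrite preimage_cst ifT ?inE // probability_setT mul1e eseries0 ?adde0 //.
  move=> j jn _; rewrite preimage_cst ifN ?measure0 ?mul0e //.
  by apply/negP; rewrite inE /= => nj; rewrite nj ltnn in jn.
by move=> fE; rewrite EFinM -fE muleAC -EFinM divff // mul1e.
Qed.

End factorial_moments.

(** * The method of moments *)

Lemma ffactnD n a b : (n ^_ (a + b) = n ^_ a * (n - a) ^_ b)%N.
Proof.
elim: b => [|b IHb]; first by rewrite addn0 ffactn0 muln1.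
by rewrite addnS !ffactnSr IHb -mulnA subnDA.
Qed.

Lemma sum_alternating_bin (R : comPzRingType) n M :
  \sum_(r < M.+1) (-1) ^+ r * 'C(n.+1, r)%:R = (-1) ^+ M * 'C(n, M)%:R :> R.
Proof.
elim: M => [|M IHM]; first by rewrite big_ord1 !bin0.
by rewrite big_ord_recr /= IHM binS natrD exprS; ring.
Qed.

(** The r-th term is ['C(w, j) * 'C(w - j, r)] up to sign. For [j < w] the alternating sum
    telescopes to plus or minus ['C(w, j) * 'C(w - j - 1, M)], which the last term kept dominates;
    for [w = j] only [r = 0] survives. *)
Lemma bonferroni (R : realFieldType) (w j M : nat) :
  `| (w == j)%:R - \sum_(r < M.+1)
       (-1) ^+ r * ((w ^_ (j + r))%:R / (j`! * r`!)%:R) | <=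
  (w ^_ (j + M))%:R / (j`! * M`!)%:R :> R.
Proof.
have ffactE r : (w ^_ (j + r))%:R / (j`! * r`!)%:R =
    'C(w, j)%:R * 'C(w - j, r)%:R :> R.
  have jr : (j`! * r`!)%:R != 0 :> R by rewrite pnatr_eq0 -lt0n muln_gt0 !fact_gt0.
  by rewrite ffactnD -!bin_ffact mulnACA natrM mulfK // natrM.
rewrite ffactE (eq_bigr (fun r : 'I_M.+1 => 'C(w, j)%:R *
    ((-1) ^+ r * 'C(w - j, r)%:R))); last by move=> r _; rewrite ffactE mulrCA.
rewrite -mulr_sumr; have [wj|jw|->] := ltngtP w j.
- by rewrite bin_small // !mul0r subr0 normr0.
- rewrite -[(w - j)%N]prednK ?subn_gt0 // sum_alternating_bin sub0r normrN.
  rewrite normrM ger0_norm // normrM normrX normrN1 expr1n mul1r ger0_norm //.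
  by rewrite ler_wpM2l // ler_nat leq_bin2l.
- rewrite subnn binn mul1r big_ord_recl /= expr0 bin0 mul1r big1 ?addr0 ?mulr1.
    by rewrite subrr normr0.
  by move=> r _; rewrite bin0n mulr0.
Qed.

Section squeeze.
Context (R : realType) (I : Type) (F : set_system I) {FF : ProperFilter F}.

(** A level [M0] whose limits are good enough is fixed before [i] moves along [F], so no uniformity
    in [M] is required of the convergences. *)
Lemma cvg_approximation (p : I -> R) (a b : nat -> I -> R) (A B : nat -> R) (L : R) :
  (forall M, \forall i \near F, `|p i - a M i| <= b M i) ->
  (forall M, a M i @[i --> F] --> A M) -> (forall M, b M i @[i --> F] --> B M) ->
  A @ \oo --> L -> B @ \oo --> (0 : R) -> p i @[i --> F] --> L.
Proof.
move=> pab aA bB AL B0; apply/cvgrPdist_le => e e0.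
have e4 : 0 < e / 4 by rewrite divr_gt0.
have : \forall M \near \oo, `|L - A M| <= e / 4 /\ `|0 - B M| <= e / 4.
  near=> M; split; near: M.
    exact: (cvgrPdist_le _ _).1 AL _ e4.
  exact: (cvgrPdist_le _ _).1 B0 _ e4.
case=> M0 _ /(_ M0) /=; rewrite leqnn => /(_ isT) [LA BM].
near=> i.
have h1 : `|p i - a M0 i| <= b M0 i by near: i; exact: pab.
have h2 : `|A M0 - a M0 i| <= e / 4.
  by near: i; exact: (cvgrPdist_le _ _).1 (aA M0) _ e4.
have h3 : `|B M0 - b M0 i| <= e / 4.
  by near: i; exact: (cvgrPdist_le _ _).1 (bB M0) _ e4.
move: LA BM h1 h2 h3; rewrite !ler_norml.
move=> /andP[? ?] /andP[? ?] /andP[? ?] /andP[? ?] /andP[? ?].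
by apply/andP; split; lra.
Unshelve. all: by end_near.
Qed.

End squeeze.

Lemma measure_nat_lt d (Omega : measurableType d) (R : realType)
    (Q : probability Omega R) (V : Omega -> nat) (K : nat) :
  (forall j, measurable [set w | V w = j]) ->
  Q [set w | (V w < K)%N] = (\sum_(j < K) Q [set w | V w = j])%E.
Proof.
move=> mV; elim: K => [|K IHK].
  by rewrite big_ord0 (_ : [set _ | _] = set0) ?measure0 //; apply/seteqP; split.
have mK : measurable [set w | (V w < K)%N].
  rewrite (_ : [set _ | _] = \bigcup_(j in `I_K) [set w | V w = j]).
    by apply: bigcup_measurable => j _; exact: mV.
  by apply/seteqP; split => w /=; [exists (V w)|case=> j /= jK ->].
rewrite big_ord_recr /= -IHK -measureU //; last first.
  by apply/seteqP; split => // w [/= VK E]; rewrite E ltnn in VK.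
congr (Q _); apply/seteqP; split => w /=.
  by rewrite ltnS leq_eqVlt => /orP[/eqP ->|]; [right|left].
by case=> [/ltnW|->]; rewrite ltnS.
Qed.

(** The case distinction matters: [Num.truncn] is 0 at a negative [r], so the formula with [.+1]
    would wrongly count the value 0. *)
Lemma cdf_nat_valued d (Omega : measurableType d) (R : realType)
    (Q : probability Omega R) (Z : {RV Q >-> R}) (V : Omega -> nat) (r : R) :
  (forall w, Z w = (V w)%:R) -> (forall j, measurable [set w | V w = j]) ->
  cdf Z r =
  (\sum_(j < if (0 <= r)%R then (Num.truncn r).+1 else 0%N) Q [set w | V w = j])%E.
Proof.
move=> ZE mV; rewrite -measure_nat_lt // /cdf /distribution /pushforward.
congr (Q _); apply/seteqP; split => w /=; rewrite in_itv /= ZE.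
  by move=> Vr; rewrite (le_trans _ Vr) // ltnS truncn_ge_nat // (le_trans _ Vr).
by case: ifP => // r0; rewrite ltnS truncn_ge_nat.
Qed.

Section method_of_moments.
Context d (Omega : measurableType d) (R : realType) (P : probability Omega R).
Context (I : Type) (F : set_system I) {FF : ProperFilter F}.
Variable W : I -> Omega -> nat.
Hypothesis mW : forall i (f : nat -> R), measurable_fun [set: Omega] (fun w => f (W i w)).
Variables (alpha : R) (alpha_gt0 : 0 < alpha) (mom : nat -> I -> R).
Hypothesis momE : forall m, \forall i \near F,
  (\int[P]_w ((W i w ^_ m)%:R)%:E = (mom m i)%:E)%E.
Hypothesis mom_cvg : forall m, mom m i @[i --> F] --> alpha ^+ m.

Lemma measurable_nat_level i j : measurable [set w | W i w = j].
Proof.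
rewrite (_ : [set w | W i w = j] = (fun w => (W i w)%:R : R) @^-1` [set j%:R]).
  by rewrite -[X in measurable X]setTI; exact: (mW i (fun a => a%:R)).
by apply/seteqP; split => w /= => [->|/eqP] //; rewrite eqr_nat => /eqP.
Qed.

(** Taking expectations in Bonferroni's inequality at level [M] uses finitely many moments, hence
    passes to the limit in [i]; then [M] tends to infinity. *)
Lemma cvg_poisson_pmf j :
  fine (P [set w | W i w = j]) @[i --> F] --> poisson_pmf alpha j.
Proof.
pose a M i : R := \sum_(r < M.+1) (-1) ^+ r * (mom (j + r) i / (j`! * r`!)%:R).
pose b M i : R := mom (j + M) i / (j`! * M`!)%:R.
pose A M : R := \sum_(r < M.+1) (-1) ^+ r * (alpha ^+ (j + r) / (j`! * r`!)%:R).
pose B M : R := alpha ^+ (j + M) / (j`! * M`!)%:R.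
apply: (@cvg_approximation _ _ _ _ _ a b A B) => [M|M|M||].
- have : \forall i \near F, forall r : 'I_M.+1,
      (\int[P]_w ((W i w ^_ (j + r))%:R)%:E = (mom (j + r) i)%:E)%E.
    by apply: filter_forall => r; exact: momE.
  apply: filterS => i mE.
  have intW (r : 'I_M.+1) :
      P.-integrable setT (EFin \o (fun w => (W i w ^_ (j + r))%:R : R)).
    apply/integrableP; split.
      by apply/measurable_EFinP; exact: (mW i (fun x => (x ^_ (j + r))%:R)).
    under eq_integral do rewrite gee0_abs ?lee_fin //.
    by rewrite mE // ltry.
  have RE (r : 'I_M.+1) : \int[P]_w (W i w ^_ (j + r))%:R = mom (j + r) i.
    by rewrite /Rintegral mE.
  pose g (r : 'I_M.+1) w : R :=
    (-1) ^+ r / (j`! * r`!)%:R * (W i w ^_ (j + r))%:R.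
  have intg r : P.-integrable setT (EFin \o g r).
    by apply: eq_integrable (integrableZl _ _ (intW r)).
  pose e w : R := (W i w == j)%:R.
  have inte : P.-integrable setT (EFin \o e).
    apply: (@integrable_bounded _ _ _ _ _ 1).
      exact: (mW i (fun x => (x == j)%:R)).
    by move=> w; rewrite /e; case: eqP; rewrite /= ?lexx ler01.
  have pE : fine (P [set w | W i w = j]) = \int[P]_w e w.
    rewrite /Rintegral; congr fine; transitivity (\int[P]_w (\1_[set w | W i w = j] w)%:E)%E.
      by rewrite integral_indic ?setIT //; exact: measurable_nat_level.
    apply: eq_integral => w _; rewrite indicE /e.
    by case: eqP => Wj; [rewrite mem_set|rewrite memNset].
  have aE : a M i = \int[P]_w (\sum_r g r w).
    rewrite Rintegral_sum //; apply: eq_bigr => r _.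
    by rewrite RintegralZl // RE; ring.
  have bE : b M i = \int[P]_w ((j`! * M`!)%:R^-1 * (W i w ^_ (j + M))%:R).
    by rewrite RintegralZl ?(RE ord_max) 1?mulrC //; exact: (intW ord_max).
  have ints : P.-integrable setT (EFin \o (fun w => \sum_r g r w)).
    rewrite (_ : _ \o _ = fun w => (\sum_(r < M.+1) (g r w)%:E)%E); last first.
      by apply/funext => w /=; rewrite sumEFin.
    by apply: integrable_sum => // r _; exact: intg.
  have intd : P.-integrable setT (EFin \o (fun w => e w - \sum_r g r w)).
    exact: eq_integrable (integrableB _ inte ints).
  rewrite pE aE bE -RintegralB //.
  apply: le_trans (le_normr_Rintegral measurableT intd) _.
  apply: le_Rintegral => //.
  + exact: eq_integrable (integrable_abse intd).
  + by apply: eq_integrable (integrableZl _ _ (intW ord_max)).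
  + move=> w _; have := bonferroni R (W i w) j M.
    rewrite [X in _ <= X -> _]mulrC; apply: le_trans.
    rewrite le_eqVlt; apply/orP; left; apply/eqP; congr (`| _ - _ |).
    by apply: eq_bigr => r _; rewrite /g; ring.
- apply: cvg_big => [|r _]; first exact: add_continuous.
  apply: cvgM; first exact: cvg_cst.
  by apply: cvgM; [exact: mom_cvg|exact: cvg_cst].
- by apply: cvgM; [exact: mom_cvg|exact: cvg_cst].
(* The limits [A] are partial sums of the series of [exp (- alpha)], times [alpha ^ j / j!]; the
   error limits [B] below are terms of the series of [exp alpha], times the same factor. *)
- rewrite (_ : A = fun M => alpha ^+ j / j`!%:R * series (exp_coeff (- alpha)) M.+1).
    rewrite /poisson_pmf alpha_gt0; apply: cvgM; first exact: cvg_cst.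
    rewrite cvg_shiftS; exact: is_cvg_series_exp_coeff.
  apply/funext => M; rewrite /A /series /= big_mkord mulr_sumr; apply: eq_bigr => r _.
  rewrite /exp_coeff /= exprD natrM -[in RHS]mulN1r exprMn invfM; ring.
- rewrite (_ : B = fun M => alpha ^+ j / j`!%:R * exp_coeff alpha M).
    rewrite -(mulr0 (alpha ^+ j / j`!%:R)); apply: cvgM; first exact: cvg_cst.
    exact: cvg_series_cvg_0 (is_cvg_series_exp_coeff alpha).
  apply/funext => M; rewrite /B /exp_coeff /= exprD natrM invfM; ring.
Qed.

Lemma cvg_cdf_Zpoisson (Y : I -> {RV P >-> R}) (r : R) :
  (forall i w, Y i w = (W i w)%:R) ->
  cdf (Y i) r @[i --> F] --> cdf (Zpoisson alpha) r.
Proof.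
move=> YE; rewrite (@cdf_nat_valued _ _ _ _ _ id) //.
under eq_cvg => i do rewrite (cdf_nat_valued _ (YE i) (measurable_nat_level i)).
apply: cvg_nnesum => j _; first exact: nearW.
rewrite (_ : [set w | _] = [set nat_of_ord j]) // poisson_law_set1 //.
apply: cvg_EFin; last exact: cvg_poisson_pmf.
by apply: nearW => i; apply: fin_num_measure; exact: measurable_nat_level.
Qed.

End method_of_moments.

Lemma cvgX (R : realType) (I : Type) (F : set_system I) {FF : Filter F}
    (f : I -> R) (l : R) n :
  f i @[i --> F] --> l -> f i ^+ n @[i --> F] --> l ^+ n.
Proof.
move=> fl; elim: n => [|n IHn]; first exact: cvg_cst.
by under eq_cvg do rewrite exprS; rewrite exprS; exact: cvgM.
Qed.

(** * From the first moment to all factorial moments *)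

Section squeeze_moments.
Context (R : realType) (I : Type) (F : set_system I) {FF : ProperFilter F}.
Variables (rho : I -> R) (Q f u c e : nat -> I -> R) (K alpha : R).
Hypothesis K_gt0 : 0 < K.
Hypothesis fQ : forall m, \forall i \near F, c m i * Q m i <= K ^+ m * f m i <= Q m i.
Hypothesis Qrho : forall m, \forall i \near F,
  rho i ^+ m <= Q m i <= u m i * rho i ^+ m + e m i.
Hypothesis u_cvg : forall m, u m i @[i --> F] --> (1 : R).
Hypothesis c_cvg : forall m, c m i @[i --> F] --> (1 : R).
Hypothesis e_cvg : forall m, e m i @[i --> F] --> (0 : R).
Hypothesis f1_cvg : f 1%N i @[i --> F] --> alpha.

(** The bounds for m = 1 are solved for [rho], which encloses it between two expressions in the
    first moment. This is the only place where the limit of the first moment enters. *)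
Let rho_cvg : rho i @[i --> F] --> K * alpha.
Proof.
apply: (@squeeze_cvgr _ _ _ _ (fun i => (K * f 1%N i - e 1%N i) / u 1%N i)
  (fun i => K * f 1%N i / c 1%N i)).
- near=> i.
  have u0 : 0 < u 1%N i by near: i; apply: (cvgr_gt (1 : R)) => //; exact: ltr01.
  have c0 : 0 < c 1%N i by near: i; apply: (cvgr_gt (1 : R)) => //; exact: ltr01.
  have : c 1%N i * Q 1%N i <= K ^+ 1 * f 1%N i <= Q 1%N i by near: i; exact: fQ.
  have : rho i ^+ 1 <= Q 1%N i <= u 1%N i * rho i ^+ 1 + e 1%N i by near: i; exact: Qrho.
  rewrite !expr1 => /andP[h1 h2] /andP[h3 h4]; apply/andP; split.
    by rewrite ler_pdivrMr //; lra.
  rewrite ler_pdivlMr //; apply: le_trans h3; rewrite mulrC ler_wpM2l //; exact: ltW.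
- rewrite -[X in _ --> X]subr0 -[X in _ --> X]divr1; apply: cvgM.
    by apply: cvgB => //; apply: cvgM => //; exact: cvg_cst.
  by apply: cvgV => //; exact: oner_neq0.
- rewrite -[X in _ --> X]divr1; apply: cvgM.
    by apply: cvgM => //; exact: cvg_cst.
  by apply: cvgV => //; exact: oner_neq0.
Unshelve. all: by end_near.
Qed.

Lemma squeeze_integrals m : Q m i @[i --> F] --> (K * alpha) ^+ m.
Proof.
apply: (@squeeze_cvgr _ _ _ _ (fun i => rho i ^+ m)
  (fun i => u m i * rho i ^+ m + e m i)); first exact: Qrho.
- exact: cvgX.
- rewrite -[X in _ --> X]addr0 -[X in _ --> X + _]mul1r; apply: cvgD => //.
  by apply: cvgM => //; exact: cvgX.
Qed.

Lemma squeeze_moments m : f m i @[i --> F] --> alpha ^+ m.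
Proof.
have Km : K ^+ m != 0 by rewrite expf_neq0 // gt_eqF.
have lim : K ^- m * (K * alpha) ^+ m = alpha ^+ m by rewrite exprMn mulKf.
have Q_cvg := @squeeze_integrals m.
apply: (@squeeze_cvgr _ _ _ _ (fun i => K ^- m * (c m i * Q m i))
  (fun i => K ^- m * Q m i)).
- near=> i.
  have /andP[h1 h2] : c m i * Q m i <= K ^+ m * f m i <= Q m i by near: i; exact: fQ.
  have fE : f m i = K ^- m * (K ^+ m * f m i) by rewrite mulKf.
  by rewrite fE !ler_wpM2l // invr_ge0 exprn_ge0 // ltW.
- rewrite -lim; apply: cvgM; first exact: cvg_cst.
  by rewrite -[X in _ --> X]mul1r; exact: cvgM.
- by rewrite -lim; apply: cvgM => //; exact: cvg_cst.
Unshelve. all: by end_near.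
Qed.

End squeeze_moments.

(** * Asymptotics *)

Section phibar_bounds.
Context d (T : measurableType d) (R : realType) (phi : T -> T -> R).
Hypothesis phi_conn : connection_function phi.

Lemma le_phibar s t : phi s t <= phibar phi.
Proof.
have [_ _ phi01] := phi_conn; apply: ub_le_sup; last by exists (s, t).
by exists 1 => _ [[x y] _ <-] /=; case/andP: (phi01 x y).
Qed.

Lemma phibar01 : 0 <= phibar phi <= 1.
Proof.
have [_ _ phi01] := phi_conn; apply/andP; split.
  by apply: le_trans (le_phibar point point); case/andP: (phi01 point point).
apply: ge_sup; first by exists (phi point point), (point, point).
by move=> _ [[x y] _ <-] /=; case/andP: (phi01 x y).
Qed.

End phibar_bounds.

Section asymptotics.
Context (R : realType) d (T : measurableType d) (mu : probability T R)
  d' (Omega : measurableType d') (P : probability Omega R).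
Variable X : nat -> {RV P >-> T}.
Hypothesis X_law : forall i, has_law (X i) mu.
Hypothesis X_indep : mutually_independent X.
Variable N : R -> {RV P >-> nat}.
Hypothesis N_law : forall s : R, 0 < s -> has_law (N s) (poisson_law s).
Hypothesis N_indep : forall s : R, 0 < s -> independent_of_points (N s) X.
Variable phi : R -> T -> T -> R.
Hypothesis phi_conn : forall s : R, 0 < s -> connection_function (phi s).
Variable E : R -> nat -> nat -> {RV P >-> bool}.
Hypothesis E_graph : forall s : R, 0 < s ->
  random_connection_graph (phi s) X (N s) (E s).
Variables (k : nat) (k_gt0 : (0 < k)%N) (alpha : R) (alpha_gt0 : 0 < alpha).
Hypothesis mean_cvg :
  ('E_P[component_RV (N s) (E s) k])%E @[s --> +oo] --> alpha%:E.

Local Notation nu := (law_of_points X).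
Let nu_iid := law_of_points_iid X_law X_indep.
Let K : R := k`!%:R.
Let K_gt0 : 0 < K. Proof. by rewrite ltr0n fact_gt0. Qed.
Let q s := phibar (phi s).

Let mom m s : R :=
  fine (\int[P]_w ((component_number k (N s) (E s) w ^_ m)%:R)%:E)%E.
Let Q m s := s ^+ (m * k) * poisson_integral nu (phi s) m k s.

Lemma momE m s : 0 < s ->
  (\int[P]_w ((component_number k (N s) (E s) w ^_ m)%:R)%:E = (mom m s)%:E)%E.
Proof.
move=> s0.
have [f fE _] := poisson_factorial_moment X_law X_indep (phi_conn s0)
  (le_phibar (phi_conn s0)) (phibar01 (phi_conn s0)) k_gt0 m s0 (N_law s0)
  (N_indep s0) (E_graph s0).
by rewrite /mom fE.
Qed.

Lemma mom_bounds m s : 0 < s ->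
  (1 - q s) ^+ (m * k * (m * k)) * Q m s <= K ^+ m * mom m s <= Q m s.
Proof.
move=> s0.
have [f fE] := poisson_factorial_moment X_law X_indep (phi_conn s0)
  (le_phibar (phi_conn s0)) (phibar01 (phi_conn s0)) k_gt0 m s0 (N_law s0)
  (N_indep s0) (E_graph s0).
by rewrite /mom fE /= /K -natrX.
Qed.

Lemma mom1_cvg : mom 1 s @[s --> +oo] --> alpha.
Proof.
have momE1 s : mom 1 s = fine ('E_P[component_RV (N s) (E s) k])%E.
  rewrite expectation_def /mom; congr fine; apply: eq_integral => w _.
  by rewrite ffactn1.
under eq_cvg do rewrite momE1.
exact: fine_cvg mean_cvg.
Qed.

Section poisson.
Hypothesis q_ln : q s * ln s @[s --> +oo] --> (0 : R).

Lemma q_cvg0 : q s @[s --> +oo] --> (0 : R).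
Proof.
apply: (@squeeze_cvgr _ _ _ _ (cst 0) (fun s => q s * ln s)) => //; last exact: cvg_cst.
near=> s.
have s0 : 0 < s by near: s; exact: nbhs_pinfty_gt.
have s1 : expR 1 <= s by near: s; exact: nbhs_pinfty_ge.
have /andP[q0 _] := phibar01 (phi_conn s0).
rewrite q0 /= ler_peMr // -[1](expRK 1) ler_ln // posrE expR_gt0 //.
Unshelve. all: by end_near.
Qed.

Lemma inv_cvg0 : s^-1 @[s --> +oo] --> (0 : R).
Proof.
apply/gtr0_cvgV0; last exact: cvg_id.
by near=> s; near: s; exact: nbhs_pinfty_gt.
Unshelve. all: by end_near.
Qed.

Let rho s := s ^+ k * reference_integral nu (phi s) k s.
(* [u m s] comes from [poisson_integral_le] with [L = 2 (m k + 1) ln s], for which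
   [s ^ (m k) * expR (- (L / 2)) = 1 / s]. *)
Let u m s := expR ((m * k)%:R * (2 * (m * k).+1%:R) * (q s * ln s)).

Lemma Q_bounds m : \forall s \near +oo,
  rho s ^+ m <= Q m s <= u m s * rho s ^+ m + s^-1.
Proof.
near=> s.
have s0 : 0 < s by near: s; exact: nbhs_pinfty_gt.
have s1 : 1 <= s by near: s; exact: nbhs_pinfty_ge.
have /andP[q0 _] := phibar01 (phi_conn s0).
have mkq : (m * k)%:R * q s <= 1 / 2.
  near: s; apply: (cvgr_le (0 : R)); last by rewrite divr_gt0.
  rewrite -[X in _ --> X](mulr0 (m * k)%:R).
  by apply: cvgM; [exact: cvg_cst|exact: q_cvg0].
have L0 : 0 <= 2 * (m * k).+1%:R * ln s by rewrite !mulr_ge0 ?ln_ge0.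
have s_exp : s ^+ (m * k) * expR (- (2 * (m * k).+1%:R * ln s / 2)) = s^-1.
  rewrite (_ : 2 * (m * k).+1%:R * ln s / 2 = (m * k).+1%:R * ln s); last by field.
  rewrite expRN expRM_natl lnK ?posrE // exprS invfM mulrCA divff ?mulr1 //.
  by rewrite expf_neq0 // gt_eqF.
have rhoX : rho s ^+ m = s ^+ (m * k) * reference_integral nu (phi s) k s ^+ m.
  by rewrite exprMn -exprM mulnC.
apply/andP; split.
  rewrite rhoX ler_wpM2l ?exprn_ge0 ?(ltW s0) //.
  exact: (poisson_integral_ge nu_iid (phi_conn s0) (le_phibar (phi_conn s0)) m k (ltW s0)).
rewrite rhoX -s_exp mulrCA -mulrDr ler_wpM2l ?exprn_ge0 ?(ltW s0) //.
have := poisson_integral_le nu_iid (phi_conn s0) (le_phibar (phi_conn s0))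
  (ltW s0) L0 q0 mkq.
rewrite (_ : (m * k)%:R * phibar (phi s) * (2 * (m * k).+1%:R * ln s) =
  (m * k)%:R * (2 * (m * k).+1%:R) * (q s * ln s)) //.
by rewrite /q; ring.
Unshelve. all: by end_near.
Qed.

Lemma u_cvg1 m : u m s @[s --> +oo] --> (1 : R).
Proof.
pose a : R := (m * k)%:R * (2 * (m * k).+1%:R).
have a0 : a * (q s * ln s) @[s --> +oo] --> (0 : R).
  by rewrite -[X in _ --> X](mulr0 a); apply: cvgM => //; exact: cvg_cst.
have := cvg_comp _ _ a0 (@continuous_expR R 0); rewrite expR0.
exact.
Qed.

Lemma c_cvg1 a : (1 - q s) ^+ a @[s --> +oo] --> (1 : R).
Proof.
have : 1 - q s @[s --> +oo] --> (1 - 0 : R).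
  by apply: cvgB; [exact: cvg_cst|exact: q_cvg0].
by move=> /(@cvgX _ _ _ _ _ _ a); rewrite subr0 expr1n.
Qed.

Let near_mom_bounds m : \forall s \near +oo,
  (1 - q s) ^+ (m * k * (m * k)) * Q m s <= K ^+ m * mom m s <= Q m s.
Proof.
near=> s; apply: mom_bounds.
by near: s; exact: nbhs_pinfty_gt.
Unshelve. all: by end_near.
Qed.

Lemma mom_cvg m : mom m s @[s --> +oo] --> alpha ^+ m.
Proof.
apply: (squeeze_moments K_gt0 near_mom_bounds Q_bounds u_cvg1 _ _ mom1_cvg).
- by move=> m'; exact: c_cvg1.
- by move=> _; exact: inv_cvg0.
Qed.

Lemma Q_cvg m : Q m s @[s --> +oo] --> (K * alpha) ^+ m.
Proof.
apply: (squeeze_integrals near_mom_bounds Q_bounds u_cvg1 _ _ mom1_cvg).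
- by move=> m'; exact: c_cvg1.
- by move=> _; exact: inv_cvg0.
Qed.

Lemma poisson_cvg_in_distribution :
  cvg_in_distribution (pinfty_nbhs R)
     (fun s => component_RV (N s) (E s) k) (Zpoisson alpha).
Proof.
move=> r _.
apply: (@cvg_cdf_Zpoisson _ _ _ P _ _ _ (fun s => component_number k (N s) (E s))
  _ alpha alpha_gt0 mom) => //.
- by move=> s f; exact: measurable_component_fun.
- move=> m; near=> s; apply: momE.
  by near: s; exact: nbhs_pinfty_gt.
- exact: mom_cvg.
Unshelve. all: by end_near.
Qed.

End poisson.

Section binomial.
Hypothesis q_sqrt : q s * Num.sqrt s @[s --> +oo] --> (0 : R).
Variable G : nat -> nat -> nat -> {RV P >-> bool}.
Hypothesis G_graph : forall n, (0 < n)%N ->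
  random_connection_graph (phi n%:R) X (cst n) (G n).

(** Since ln s = 2 ln (sqrt s) < 2 sqrt s, the binomial rate implies the Poisson one, and the limits
    of the Poisson integrals become available. *)
Lemma q_ln_of_sqrt : q s * ln s @[s --> +oo] --> (0 : R).
Proof.
have q2 : 2 * (q s * Num.sqrt s) @[s --> +oo] --> (0 : R).
  by rewrite -[X in _ --> X](mulr0 2); apply: cvgM => //; exact: cvg_cst.
apply: (squeeze_cvgr _ (cvg_cst (0 : R)) q2).
near=> s.
have s0 : 0 < s by near: s; exact: nbhs_pinfty_gt.
have s1 : 1 <= s by near: s; exact: nbhs_pinfty_ge.
have /andP[q0 _] := phibar01 (phi_conn s0).
rewrite mulr_ge0 ?ln_ge0 //= mulrCA ler_wpM2l // -[X in ln X](sqr_sqrtr (ltW s0)).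
rewrite lnXn ?sqrtr_gt0 // mulr2n.
have : ln (Num.sqrt s) < Num.sqrt s by rewrite ln_sublinear ?sqrtr_gt0.
lra.
Unshelve. all: by end_near.
Qed.

Let momB m n : R :=
  fine (\int[P]_w ((component_number k (cst n) (G n) w ^_ m)%:R)%:E)%E.
Let QB m n : R := (n ^_ (m * k))%:R * blocks_integral nu (phi n%:R) m k n.

Lemma momB_bounds m n : (0 < n)%N ->
  (\int[P]_w ((component_number k (cst n) (G n) w ^_ m)%:R)%:E = (momB m n)%:E)%E /\
  (1 - q n%:R) ^+ (m * k * (m * k)) * QB m n <= K ^+ m * momB m n <= QB m n.
Proof.
move=> n0; have n0R : (0 : R) < n%:R by rewrite ltr0n.
have [f fE] := binomial_factorial_moment X_law X_indep (phi_conn n0R)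
  (le_phibar (phi_conn n0R)) (phibar01 (phi_conn n0R)) k_gt0 m (G_graph n0).
by rewrite /momB fE /= /K -natrX.
Qed.

Lemma ffact_ratio_cvg M : (n ^_ M)%:R / n%:R ^+ M @[n --> \oo] --> (1 : R).
Proof.
elim: M => [|M IHM].
  by under eq_cvg do rewrite ffactn0 expr0 divr1; exact: cvg_cst.
have inv_n : (n%:R : R)^-1 @[n --> \oo] --> (0 : R).
  exact: cvg_comp cvgr_idn inv_cvg0.
have lim1 : (n ^_ M)%:R / n%:R ^+ M * (1 - M%:R * n%:R^-1) @[n --> \oo] --> (1 : R).
  rewrite -[X in _ --> X]mulr1; apply: cvgM => //.
  rewrite -[X in _ --> X]subr0; apply: cvgB; first exact: cvg_cst.
  by rewrite -[X in _ --> X](mulr0 M%:R); apply: cvgM => //; exact: cvg_cst.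
apply: cvg_trans lim1; apply: near_eq_cvg; near=> n.
have nM : (M < n)%N by near: n; exact: nbhs_infty_gt.
have n0 : n%:R != 0 :> R by rewrite pnatr_eq0 -lt0n (leq_ltn_trans _ nM).
rewrite ffactnSr natrM natrB ?(ltnW nM) // exprSr invfM.
by rewrite -[X in X - _](mulfV n0); ring.
Unshelve. all: by end_near.
Qed.

(** The binomial integral is compared with the Poisson one of intensity [n]. The ratio of falling
    factorial to power accounts for drawing the points without repetition, and the exponent
    [n q ^ 2] is rewritten as the square of [q * sqrt n]. *)
Lemma QB_bounds m : \forall n \near \oo,
  (n ^_ (m * k))%:R / n%:R ^+ (m * k) *
    expR (- (2 * (m * k)%:R ^+ 2) * (q n%:R * Num.sqrt n%:R) ^+ 2) * Q m n%:R
  <= QB m n <= expR ((m * k)%:R * (m * k)%:R * q n%:R) * Q m n%:R.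
Proof.
near=> n.
have n0 : (0 < n)%N by near: n; exact: nbhs_infty_gt.
have nM : (m * k <= n)%N by near: n; exact: nbhs_infty_ge.
have n0R : (0 : R) < n%:R by rewrite ltr0n.
have /andP[q0 _] := phibar01 (phi_conn n0R).
have mkq : (m * k)%:R * q n%:R <= 1 / 2.
  near: n; apply: (cvgr_le (0 : R)); last by rewrite divr_gt0.
  rewrite -[X in _ --> X](mulr0 (m * k)%:R); apply: cvgM; first exact: cvg_cst.
  exact: cvg_comp cvgr_idn (q_cvg0 q_ln_of_sqrt).
have phile := le_phibar (phi_conn n0R).
have nX : n%:R ^+ (m * k) != 0 :> R by rewrite expf_neq0 // gt_eqF.
have pois0 : 0 <= poisson_integral nu (phi n%:R) m k n%:R.
  apply: Rintegral_ge0 => x _; rewrite mulr_ge0 ?expR_ge0 //.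
  by case/andP: (conn_blocks01 (phi_conn n0R) m k x).
apply/andP; split.
  have h := blocks_integral_ge nu (phi_conn n0R) phile n q0 mkq.
  have E1 : - (2 * (m * k)%:R ^+ 2) * (q n%:R * Num.sqrt n%:R) ^+ 2 =
      - (2 * (n%:R * ((m * k)%:R * phibar (phi n%:R)) ^+ 2)).
    by rewrite exprMn sqr_sqrtr ?(ltW n0R) // /q; ring.
  rewrite /Q mulrAC mulrA divfK // -mulrA /QB ler_wpM2l // E1 mulrC.
  exact: h.
have h := blocks_integral_le nu (phi_conn n0R) phile q0 nM.
rewrite /QB /Q mulrCA; apply: ler_pM => //.
- exact: blocks_integral_ge0 (phi_conn n0R) _ _ _.
- rewrite -natrX ler_nat ffact_prod -[X in (_ <= n ^ X)%N]card_ord -prod_nat_const.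
  by apply: leq_prod => i _; exact: leq_subr.
- by rewrite -[X in expR X * _]mulrA; exact: h.
Unshelve. all: by end_near.
Qed.

(** No binomial moment is assumed to converge, so the case m = 1 cannot serve as the anchor here.
    The limit comes from the Poisson integrals [Q] along integer intensities. *)
Lemma momB_cvg m : momB m n @[n --> \oo] --> alpha ^+ m.
Proof.
have q_nat (f : R -> R) (l : R) : f s @[s --> +oo] --> l ->
    f n%:R @[n --> \oo] --> l by exact: cvg_comp cvgr_idn.
have Km : K ^+ m != 0 by rewrite expf_neq0 // gt_eqF.
have QN : Q m n%:R @[n --> \oo] --> (K * alpha) ^+ m.
  exact: q_nat (Q_cvg q_ln_of_sqrt (m := m)).
have exp_cvg (c : R) (g : nat -> R) : g n @[n --> \oo] --> (0 : R) ->
    expR (c * g n) @[n --> \oo] --> (1 : R).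
  move=> g0; have cg0 : c * g n @[n --> \oo] --> (0 : R).
    by rewrite -[X in _ --> X](mulr0 c); apply: cvgM => //; exact: cvg_cst.
  by have := cvg_comp _ _ cg0 (@continuous_expR R 0); rewrite expR0; exact.
pose M := (m * k)%N.
pose a n : R := (n ^_ M)%:R / n%:R ^+ M *
  expR (- (2 * M%:R ^+ 2) * (q n%:R * Num.sqrt n%:R) ^+ 2).
pose b n : R := expR (M%:R * M%:R * q n%:R).
have a1 : a n @[n --> \oo] --> (1 : R).
  rewrite -[X in _ --> X]mulr1; apply: cvgM; first exact: ffact_ratio_cvg.
  by apply: exp_cvg; have := cvgX (n := 2) (q_nat _ _ q_sqrt); rewrite expr0n; apply.
have b1 : b n @[n --> \oo] --> (1 : R).
  by apply: exp_cvg; exact: q_nat (q_cvg0 q_ln_of_sqrt).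
pose c n : R := (1 - q n%:R) ^+ (M * M).
have c1 : c n @[n --> \oo] --> (1 : R) := q_nat _ _ (c_cvg1 q_ln_of_sqrt (M * M)).
have lim : K ^- m * (K * alpha) ^+ m = alpha ^+ m by rewrite exprMn mulKf.
apply: (@squeeze_cvgr _ _ _ _ (fun n => K ^- m * (c n * (a n * Q m n%:R)))
  (fun n => K ^- m * (b n * Q m n%:R))).
- near=> n.
  have n0 : (0 < n)%N by near: n; exact: nbhs_infty_gt.
  have [_ /andP[h1 h2]] := momB_bounds m n0.
  have : a n * Q m n%:R <= QB m n <= b n * Q m n%:R by near: n; exact: QB_bounds.
  move=> /andP[h3 h4].
  have c0 : 0 <= c n.
    have n0R : (0 : R) < n%:R by rewrite ltr0n.
    by rewrite exprn_ge0 // subr_ge0; case/andP: (phibar01 (phi_conn n0R)).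
  have fE : momB m n = K ^- m * (K ^+ m * momB m n) by rewrite mulKf.
  have K0 : 0 <= K ^- m by rewrite invr_ge0 exprn_ge0 // ltW.
  rewrite fE; apply/andP; split; rewrite ler_wpM2l //.
    by apply: le_trans h1; rewrite ler_wpM2l.
  exact: le_trans h2 h4.
- rewrite -lim; apply: cvgM; first exact: cvg_cst.
  rewrite -[X in _ --> X]mul1r; apply: cvgM => //.
  by rewrite -[X in _ --> X]mul1r; exact: cvgM.
- rewrite -lim; apply: cvgM; first exact: cvg_cst.
  by rewrite -[X in _ --> X]mul1r; exact: cvgM.
Unshelve. all: by end_near.
Qed.

Lemma binomial_cvg_in_distribution :
  cvg_in_distribution (pinfty_nbhs R)
     (fun s => component_RV (cst (Num.truncn s)) (G (Num.truncn s)) k)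
     (Zpoisson alpha).
Proof.
move=> r _.
(* The count depends on [s] only through its integer part, so convergence along the integers is
   enough. *)
have truncn_cvg : Num.truncn s @[s --> (+oo : set_system R)] --> \oo.
  move=> A [n0 _ nA]; apply: filterS (nbhs_pinfty_ge (num_real (n0%:R : R))).
  move=> s n0s; apply: nA => /=; rewrite truncn_ge_nat //.
  exact: le_trans n0s.
apply: (cvg_comp _ (fun n => cdf (component_RV (cst n) (G n) k) r) truncn_cvg).
apply: (@cvg_cdf_Zpoisson _ _ _ P _ _ _ (fun n => component_number k (cst n) (G n))
  _ alpha alpha_gt0 momB) => //.
- by move=> n f; exact: measurable_component_fun.
- move=> m; near=> n; apply: (momB_bounds m _).1.
  by near: n; exact: nbhs_infty_gt.
- exact: momB_cvg.
Unshelve. all: by end_near.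
Qed.

End binomial.

End asymptotics.
Theorem theorem2p2 (R : realType)
  (d : measure_display) (T : measurableType d) (mu : probability T R)
  (d' : measure_display) (Omega : measurableType d') (P : probability Omega R)
  (X : nat -> {RV P >-> T})
  (X_law : forall i, has_law (X i) mu)
  (X_indep : mutually_independent X)
  (N : R -> {RV P >-> nat})
  (N_law : forall s : R, 0 < s -> has_law (N s) (poisson_law s))
  (N_indep : forall s : R, 0 < s -> independent_of_points (N s) X)
  (phi : R -> T -> T -> R)
  (phi_conn : forall s : R, 0 < s -> connection_function (phi s))
  (E : R -> nat -> nat -> {RV P >-> bool})
  (E_graph : forall s : R, 0 < s ->
     random_connection_graph (phi s) X (N s) (E s))
  (k : nat) (k_gt0 : (0 < k)%N)
  (alpha : R) (alpha_gt0 : 0 < alpha)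
  (mean_cvg :
     ('E_P[component_RV (N s) (E s) k])%E @[s --> +oo] --> alpha%:E) :
  (phibar (phi s) / (1 / ln s) @[s --> +oo] --> (0 : R) ->
   cvg_in_distribution (pinfty_nbhs R)
     (fun s => component_RV (N s) (E s) k) (Zpoisson alpha))
  /\
  (phibar (phi s) / (s `^ (- (1 / 2))) @[s --> +oo] --> (0 : R) ->
   forall F : nat -> nat -> nat -> {RV P >-> bool},
   (forall n, (0 < n)%N ->
      random_connection_graph (phi n%:R) X (cst n) (F n)) ->
   cvg_in_distribution (pinfty_nbhs R)
     (fun s => component_RV (cst (Num.truncn s)) (F (Num.truncn s)) k)
     (Zpoisson alpha)).
Proof.
split=> [q_ln|q_sqrt G G_graph].
  apply: (poisson_cvg_in_distribution X_law X_indep N_law N_indep phi_conn E_graph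
    k_gt0 alpha_gt0 mean_cvg).
  by apply: cvg_trans q_ln; apply: near_eq_cvg; apply: nearW => s; rewrite div1r invrK.
apply: (binomial_cvg_in_distribution X_law X_indep N_law N_indep phi_conn E_graph
  k_gt0 alpha_gt0 mean_cvg _ G_graph).
apply: cvg_trans q_sqrt; apply: near_eq_cvg; near=> s.
rewrite powRN invrK div1r powR12_sqrt //.
Unshelve. all: by end_near.
Qed.
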